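(* Let $f:\mathbb T^2\to\mathbb C$ be continuous. Then the following convergences hold uniformly in $t\in\mathbb Z_q^\times$ as $q\to\infty$: (i) for any sequence of $q$: $\frac{1}{\phi(q)}\sum_{p\in\mathbb Z_q^\times}f\big(\frac pq,\frac{t\overline p}{q}\big)\to\int_{\mathbb T^2}f(x)\,dx$; (ii) for $q\equiv0\bmod4$ not a square and every $\sigma\in\{\pm1,\pm i\}$: $\frac{1}{\phi(q)}\sum_{p\in\mathbb Z_q^\times,\ \epsilon_p(\frac qp)=\sigma}f\big(\frac pq,\frac{t\overline p}{q}\big)\to\frac14\int_{\mathbb T^2}f(x)\,dx$; (iii) for $q\equiv0\bmod4$ and every $\sigma\in\{\pm1\}$: $\frac{1}{\phi(q)}\sum_{p\in\mathbb Z_q^\times,\ p\equiv\sigma\bmod4}f\big(\frac pq,\frac{t\overline p}{q}\big)\to\frac12\int_{\mathbb T^2}f(x)\,dx$; (iv) for $q\equiv1\bmod2$ not a square and every $\sigma\in\{\pm1\}$: $\frac{1}{\phi(q)}\sum_{p\in\mathbb Z_q^\times,\ (\frac pq)=\sigma}f\big(\frac pq,\frac{t\overline p}{q}\big)\to\frac12\int_{\mathbb T^2}f(x)\,dx$.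
   Context: $\mathbb T=\mathbb R/\mathbb Z$; $\mathbb Z_q^\times=\{p\in\{1,\dots,q\}:\gcd(p,q)=1\}$ and $\phi(q)=|\mathbb Z_q^\times|$; $\overline p$ denotes the inverse of $p$ modulo $q$. For an integer $a$, $\epsilon_a=1$ if $a\equiv1\bmod4$ and $\epsilon_a=i$ if $a\equiv3\bmod4$. $(\frac ab)$ denotes the Jacobi symbol (for positive odd $b$, the multiplicative extension of the Legendre symbol over the prime factorization of $b$). *)

(* Defs.v *)
From Stdlib Require Import Reals ZArith ClassicalEpsilon.
From Coquelicot Require Import Coquelicot.
From mathcomp Require Import ssreflect ssrfun ssrbool eqtype ssrnat seq div prime fintype.

Definition units_mod (q : nat) : seq nat := [seq p <- iota 1 q | coprime p q].

(* overline p : the inverse of p modulo q (a representative in {0,...,q-1};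
   only its class mod q matters below since f is 1-periodic). *)
Definition inv_mod (q p : nat) : nat :=
  match [pick k : 'I_q | (p * k) %% q == 1 %% q] with
  | Some k => nat_of_ord k
  | None => 0
  end.

Definition legendre (a p : nat) : Z :=
  if p %| a then 0%Z
  else if [exists x : 'I_p, (x * x) %% p == a %% p] then 1%Z else (-1)%Z.

Definition jacobi (a b : nat) : Z :=
  foldr (fun p acc => (legendre a p ^ Z.of_nat (logn p b) * acc)%Z) 1%Z (primes b).

Definition epsilon4 (a : nat) : C := if (a %% 4 == 1)%N then RtoC 1 else Ci.

Definition csum (l : seq nat) (g : nat -> C) : C :=
  foldr (fun p acc => Cplus (g p) acc) (RtoC 0) l.

Definition avg (f : R * R -> C) (q t : nat) (P : nat -> bool) : C :=
  Cmult (RtoC (/ INR (totient q)))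
    (csum [seq p <- units_mod q | P p]
       (fun p => f (INR p / INR q, INR (t * inv_mod q p) / INR q)%R)).

Definition integral_T2 (f : R * R -> C) : C :=
  @RInt C_R_CompleteNormedModule (fun x => @RInt C_R_CompleteNormedModule (fun y => f (x, y)) 0 1) 0 1.

Definition is_square (q : nat) : Prop := exists m : nat, q = (m * m)%N.

Definition asbool (P : Prop) : bool :=
  if excluded_middle_informative P then true else false.

(* Main.v *)
(** Fourier analysis reduces each limit to averages of [chi(p) e((k p + l t p^-1) / q)] with [chi]
    a real character modulo [q]; these are normalised Kloosterman sums [S(k, l t)].
    Since [|S(a, b)| = |S(a u, b / u)|] for units [u], and since the fourth moment of [S] over all
    [(a, b)] is at most [q^2] times the number of solutions of
    [x1 + x2 = x3 + x4, 1/x1 + 1/x2 = 1/x3 + 1/x4], a single sum with [(k, l) <> (0, 0)] satisfies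
    [phi(q) |S|^4 << q^4 d(q)^2], so that [S = o(phi(q))], uniformly in [t] and [chi].
    The passage to continuous [f] uses interpolation at the grid [(j/M, k/M)] by Fejer kernels,
    whose constant term is a Riemann sum of [f]. The conditions in (ii)-(iv) are combinations of the
    characters [chi4], [(p/q)] and [(q/p)]; the last one is a character modulo [q] by quadratic
    reciprocity, and it is nonprincipal because [q] is not a square. *)
Require Import Defs.
From Stdlib Require Import Reals ZArith ClassicalEpsilon Lra Lia.
From Coquelicot Require Import Coquelicot.
Local Open Scope R_scope.

(** * Uniform continuity and Riemann sums *)

(** Any fixed power saving is enough, so no Weil bound is used; the moment method treats every
    modulus and every character alike, and only sizes of annihilators enter. The factor [phi(q)]
    arises because the pairs [(a u, b / u)] occupy [phi(q)] places in the fourth moment, each [a u]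
    being repeated at most as often as the annihilator of [a] is large. For a nonzero frequency
    bounded by [M] that size is at most [M] whatever [q] is, and multiplying the second frequency by
    the unit [t] does not change it; this is where uniformity in [t] comes from. The factor [d(q)^2]
    comes from counting the quadruples, through the square of the sum of gcd(v, q) over [v].
    Interpolation at a grid keeps everything a finite sum, so that no Fourier coefficient has to be
    integrated; its error is controlled by a Korovkin inequality. The mean of [chi] stays in the
    limit as a factor, so one limit statement covers all characters, and nonprincipality is used
    only when the indicators are expanded. *)

Lemma Cmod_le_Rabs (z : C) : Cmod z <= Rabs (fst z) + Rabs (snd z).
Proof.
unfold Cmod; apply Rsqr_incr_0_var.
- rewrite Rsqr_sqrt; [|nra].
  unfold Rsqr; rewrite <- (pow2_abs (fst z)), <- (pow2_abs (snd z)).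
  generalize (Rabs_pos (fst z)) (Rabs_pos (snd z)); nra.
- generalize (Rabs_pos (fst z)) (Rabs_pos (snd z)); lra.
Qed.

Lemma continuity_2d_fst (f : R * R -> C) (x y : R) :
  continuous f (x, y) -> continuity_2d_pt (fun u v => fst (f (u, v))) x y.
Proof.
intros fc; apply continuity_2d_pt_filterlim.
apply (filterlim_ext (fun z : R * R => fst (f z))); [intros [u v]; reflexivity|].
apply (filterlim_comp _ _ _ f fst _ (locally (f (x, y)))); [exact fc|].
destruct (f (x, y)) as [a b]; apply continuous_fst.
Qed.

Lemma continuity_2d_snd (f : R * R -> C) (x y : R) :
  continuous f (x, y) -> continuity_2d_pt (fun u v => snd (f (u, v))) x y.
Proof.
intros fc; apply continuity_2d_pt_filterlim.
apply (filterlim_ext (fun z : R * R => snd (f z))); [intros [u v]; reflexivity|].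
apply (filterlim_comp _ _ _ f snd _ (locally (f (x, y)))); [exact fc|].
destruct (f (x, y)) as [a b]; apply continuous_snd.
Qed.

Lemma uniform_continuity_C (f : R * R -> C) (a b : R) :
  (forall z, continuous f z) -> forall eps, 0 < eps -> exists delta, 0 < delta /\
  forall x y u v, a <= x <= b -> a <= y <= b -> a <= u <= b -> a <= v <= b ->
    Rabs (u - x) < delta -> Rabs (v - y) < delta -> Cmod (f (u, v) - f (x, y))%C < eps.
Proof.
intros fc eps eps_gt0.
assert (e2 : 0 < eps / 2) by lra.
destruct (uniform_continuity_2d (fun u v => fst (f (u, v))) a b a b
  (fun x y _ _ => continuity_2d_fst f x y (fc (x, y))) (mkposreal _ e2)) as [d1 H1].
destruct (uniform_continuity_2d (fun u v => snd (f (u, v))) a b a b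
  (fun x y _ _ => continuity_2d_snd f x y (fc (x, y))) (mkposreal _ e2)) as [d2 H2].
exists (Rmin d1 d2); split; [apply Rmin_pos; apply cond_pos|].
intros x y u v hx hy hu hv du dv.
assert (du1 := Rlt_le_trans _ _ _ du (Rmin_l _ _)); assert (du2 := Rlt_le_trans _ _ _ du (Rmin_r _ _)).
assert (dv1 := Rlt_le_trans _ _ _ dv (Rmin_l _ _)); assert (dv2 := Rlt_le_trans _ _ _ dv (Rmin_r _ _)).
specialize (H1 x y u v hx hy hu hv du1 dv1); specialize (H2 x y u v hx hy hu hv du2 dv2).
simpl in H1, H2.
eapply Rle_lt_trans; [apply Cmod_le_Rabs|]; simpl; unfold Rminus in *; lra.
Qed.

(** * Periodic functions: boundedness and Korovkin's inequality *)

Lemma periodic_nat (f : R * R -> C) (n : nat) : (forall x y, f (x + 1, y) = f (x, y)) ->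
  forall x y, f (x + INR n, y) = f (x, y).
Proof.
intros fp; induction n as [|n IH]; intros x y; [now rewrite Rplus_0_r|].
now rewrite S_INR, <- Rplus_assoc, fp, IH.
Qed.

Lemma periodic_Z (f : R * R -> C) (k : Z) : (forall x y, f (x + 1, y) = f (x, y)) ->
  forall x y, f (x + IZR k, y) = f (x, y).
Proof.
intros fp x y; destruct (Z_le_gt_dec 0 k) as [k0|k0].
- rewrite <- (Z2Nat.id k) by assumption; rewrite <- INR_IZR_INZ; now apply periodic_nat.
- rewrite <- (periodic_nat f (Z.to_nat (- k)) fp (x + IZR k)), INR_IZR_INZ, Z2Nat.id by lia.
  rewrite opp_IZR; do 2 f_equal; ring.
Qed.

Lemma periodic_Z2 (f : R * R -> C) (k l : Z) : (forall x y, f (x + 1, y) = f (x, y)) ->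
  (forall x y, f (x, y + 1) = f (x, y)) -> forall x y, f (x + IZR k, y + IZR l) = f (x, y).
Proof.
intros f1 f2 x y; rewrite (periodic_Z f k f1).
exact (periodic_Z (fun z => f (snd z, fst z)) l (fun u v => f2 v u) y x).
Qed.

Lemma shift_near (x x' : R) : exists k : Z, - / 2 <= x - (x' + IZR k) <= / 2.
Proof.
destruct (archimed (x - x' - / 2)) as [h1 h2].
exists (up (x - x' - / 2)); lra.
Qed.

Lemma shift_unit (x : R) : exists k : Z, 0 <= x + IZR k <= 1.
Proof.
destruct (archimed x) as [h1 h2].
exists (1 - up x)%Z; rewrite minus_IZR; lra.
Qed.

(** Uniform continuity with tolerance 1 is applied along the segment from the origin to a point of
    the unit square: [n] equal steps, where [/ INR n < d], each change the value by less than 1, so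
    the modulus is at most [Cmod (f (0, 0)) + INR n]. *)
Lemma periodic_bounded (f : R * R -> C) : (forall z, continuous f z) ->
  (forall x y, f (x + 1, y) = f (x, y)) -> (forall x y, f (x, y + 1) = f (x, y)) ->
  exists B : nat, forall x y, Cmod (f (x, y)) <= INR B.
Proof.
intros fc f1 f2.
destruct (uniform_continuity_C f 0 1 fc 1 Rlt_0_1) as [d [d_gt0 H]].
destruct (archimed_cor1 d d_gt0) as [n [nd n_gt0]].
destruct (INR_unbounded (Cmod (f (0, 0)) + INR n)) as [B hB].
exists B; intros x y.
destruct (shift_unit x) as [k hk]; destruct (shift_unit y) as [l hl].
rewrite <- (periodic_Z2 f k l f1 f2 x y).
revert hk hl; generalize (x + IZR k) (y + IZR l); clear x y k l; intros x y hx hy.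
assert (nR : 0 < INR n) by (apply lt_0_INR; lia).
assert (step : forall m, (m <= n)%nat ->
  Cmod (f (INR m / INR n * x, INR m / INR n * y)) <= Cmod (f (0, 0)) + INR m).
{ induction m as [|m IH]; intros hm.
  - simpl; unfold Rdiv; rewrite !Rmult_0_l, Rplus_0_r; apply Rle_refl.
  - assert (hm' : (m <= n)%nat) by lia; specialize (IH hm').
    assert (mn : INR m + 1 <= INR n) by (rewrite <- S_INR; now apply le_INR).
    assert (m0 := pos_INR m).
    set (a := INR m / INR n) in *; set (b := INR (S m) / INR n).
    assert (ba : b = a + / INR n) by (unfold a, b; rewrite S_INR; field; lra).
    assert (i0 : 0 < / INR n) by now apply Rinv_0_lt_compat.
    assert (a0 : 0 <= a) by (unfold a, Rdiv; apply Rmult_le_pos; lra).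
    assert (b1 : b <= 1).
    { unfold b; rewrite S_INR; apply (Rmult_le_reg_r (INR n)); [lra|].
      unfold Rdiv; rewrite Rmult_assoc, Rinv_l; lra. }
    assert (near : forall z, 0 <= z <= 1 -> Rabs (b * z - a * z) < d).
    { intros z hz; replace (b * z - a * z) with (/ INR n * z) by (rewrite ba; ring).
      rewrite Rabs_pos_eq; nra. }
    assert (in01 : forall c z, 0 <= c <= 1 -> 0 <= z <= 1 -> 0 <= c * z <= 1) by (intros; nra).
    assert (h := H (a * x) (a * y) (b * x) (b * y) (in01 a x ltac:(lra) hx) (in01 a y ltac:(lra) hy)
      (in01 b x ltac:(lra) hx) (in01 b y ltac:(lra) hy) (near x hx) (near y hy)).
    replace (f (b * x, b * y)) with (Cplus (Cminus (f (b * x, b * y)) (f (a * x, a * y))) (f (a * x, a * y))) by ring.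
    eapply Rle_trans; [apply Cmod_triangle|]; rewrite S_INR; lra. }
specialize (step n (le_n n)).
replace (INR n / INR n) with 1 in step by (field; lra).
rewrite !Rmult_1_l in step; lra.
Qed.

Lemma sin_sqr_period (x : R) (k : Z) : sin (PI * (x + IZR k)) ^ 2 = sin (PI * x) ^ 2.
Proof.
assert (h := periodic_Z (fun z => RtoC (sin (PI * fst z) ^ 2)) k).
simpl in h; specialize (fun H => h H x 0); apply (f_equal fst) in h; [exact h|].
intros u _; f_equal; rewrite Rmult_plus_distr_l, Rmult_1_r, neg_sin; ring.
Qed.

Lemma sin_sqr_lower (d u : R) : 0 < d -> d <= Rabs u -> Rabs u <= / 2 ->
  sin (PI * d) ^ 2 <= sin (PI * u) ^ 2.
Proof.
intros d0 du u2; assert (pi0 := PI_RGT_0).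
assert (e : sin (PI * u) ^ 2 = sin (PI * Rabs u) ^ 2).
{ unfold Rabs; destruct (Rcase_abs u); [|reflexivity].
  replace (PI * - u) with (- (PI * u)) by ring; rewrite sin_neg; ring. }
rewrite e; apply pow_incr; split; [apply sin_ge_0; nra|].
apply sin_incr_1; nra.
Qed.

(* Korovkin's inequality for the test functions [|e(x) - e(x')|^2 = 4 sin^2 (pi (x - x'))]. *)
Lemma periodic_korovkin (f : R * R -> C) : (forall z, continuous f z) ->
  (forall x y, f (x + 1, y) = f (x, y)) -> (forall x y, f (x, y + 1) = f (x, y)) ->
  forall eps, 0 < eps -> exists A : nat, forall x y x' y',
    Cmod (f (x, y) - f (x', y'))%C <=
    eps + INR A * (4 * sin (PI * (x - x')) ^ 2 + 4 * sin (PI * (y - y')) ^ 2).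
Proof.
intros fc f1 f2 eps eps_gt0.
destruct (periodic_bounded f fc f1 f2) as [B hB].
(* After the integer shifts below, [x] lies in [0, 1] and [x'] within 1/2 of it, so all coordinates
   stay in [-1, 2]. *)
destruct (uniform_continuity_C f (-1) 2 fc eps eps_gt0) as [d' [d'_gt0 H]].
set (d := Rmin d' (/ 2)).
assert (d_gt0 : 0 < d) by (apply Rmin_pos; lra).
assert (dd' := Rmin_l d' (/ 2) : d <= d'); assert (d2 := Rmin_r d' (/ 2) : d <= / 2).
(* When a shifted coordinate difference is at least [d], the bracket is at least [c]; since [A] will
   satisfy [A c >= 2 B], the trivial bound [2 B] is then enough. *)
set (c := 4 * sin (PI * d) ^ 2).
assert (c_gt0 : 0 < c).
{ assert (pi0 := PI_RGT_0); assert (0 < sin (PI * d)) by (apply sin_gt_0; nra).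
  unfold c; simpl; nra. }
destruct (INR_unbounded (2 * INR B / c)) as [A hA].
exists A; intros x y x' y'.
destruct (shift_unit x) as [k hk]; destruct (shift_unit y) as [l hl].
destruct (shift_near (x + IZR k) x') as [k' hk']; destruct (shift_near (y + IZR l) y') as [l' hl'].
rewrite <- (periodic_Z2 f k l f1 f2 x y), <- (periodic_Z2 f k' l' f1 f2 x' y').
assert (sh : forall u u' i i', sin (PI * (u - u')) ^ 2 = sin (PI * ((u + IZR i) - (u' + IZR i'))) ^ 2).
{ intros u u' i i'; rewrite <- (sin_sqr_period (u - u') (i - i')), minus_IZR.
  do 3 f_equal; ring. }
rewrite (sh x x' k k'), (sh y y' l l'); clear sh.
revert hk hl hk' hl'; generalize (x + IZR k) (y + IZR l) (x' + IZR k') (y' + IZR l').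
clear x y x' y' k l k' l'; intros x y x' y' hx hy hx' hy'.
assert (A0 := pos_INR A).
assert (sx := pow2_ge_0 (sin (PI * (x - x')))); assert (sy := pow2_ge_0 (sin (PI * (y - y')))).
assert (far : c <= 4 * sin (PI * (x - x')) ^ 2 + 4 * sin (PI * (y - y')) ^ 2 ->
  Cmod (f (x, y) - f (x', y'))%C <=
  eps + INR A * (4 * sin (PI * (x - x')) ^ 2 + 4 * sin (PI * (y - y')) ^ 2)).
{ intros hc.
  assert (b : Cmod (f (x, y) - f (x', y'))%C <= 2 * INR B).
  { eapply Rle_trans; [apply Cmod_triangle|]; rewrite Cmod_opp.
    generalize (hB x y) (hB x' y'); lra. }
  assert (e : 2 * INR B <= INR A * c).
  { replace (2 * INR B) with (2 * INR B / c * c) by (field; lra).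
    apply Rmult_le_compat_r; lra. }
  assert (INR A * c <= INR A * (4 * sin (PI * (x - x')) ^ 2 + 4 * sin (PI * (y - y')) ^ 2))
    by (apply Rmult_le_compat_l; lra).
  lra. }
destruct (Rlt_le_dec (Rabs (x - x')) d) as [nx|fx].
- destruct (Rlt_le_dec (Rabs (y - y')) d) as [ny|fy].
  + assert (h : Cmod (f (x, y) - f (x', y'))%C < eps) by (apply H; lra).
    assert (0 <= INR A * (4 * sin (PI * (x - x')) ^ 2 + 4 * sin (PI * (y - y')) ^ 2))
      by (apply Rmult_le_pos; lra).
    lra.
  + apply far; assert (h := sin_sqr_lower d (y - y') d_gt0 fy ltac:(apply Rabs_le; lra)); unfold c; lra.
- apply far; assert (h := sin_sqr_lower d (x - x') d_gt0 fx ltac:(apply Rabs_le; lra)); unfold c; lra.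
Qed.

(** * Riemann sums in one and two variables *)

Fixpoint prefix_sum (n : nat) (g : nat -> C) : C :=
  match n with O => RtoC 0 | S n => (prefix_sum n g + g n)%C end.

(** On each cell of length [1 / M] the integrand stays within [e] of its value at the left endpoint,
    and Chasles' relation adds the cells up. The modulus of continuity is a hypothesis so that the
    same lemma serves the slices of [f] and the inner integral as a function of the first
    variable. *)
Lemma riemann_sum_C (g : R -> C) (M : nat) (e : R) : (0 < M)%nat ->
  (forall z, 0 <= z <= 1 -> continuous g z) ->
  (forall u v, 0 <= u <= 1 -> 0 <= v <= 1 -> Rabs (u - v) <= / INR M -> Cmod (g u - g v)%C <= e) ->
  Cmod (@RInt C_R_CompleteNormedModule g 0 1 -
    RtoC (/ INR M) * prefix_sum M (fun j => g (INR j / INR M)%R))%C <= e.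
Proof.
intros M_gt0 gc ge; assert (MR : 0 < INR M) by now apply lt_0_INR.
assert (i0 : 0 < / INR M) by now apply Rinv_0_lt_compat.
assert (frac : forall n, (n <= M)%nat -> 0 <= INR n / INR M <= 1).
{ intros n hn; assert (n0 := pos_INR n); assert (h := le_INR _ _ hn); split.
  - unfold Rdiv; apply Rmult_le_pos; lra.
  - apply (Rmult_le_reg_r (INR M)); [lra|]; unfold Rdiv; rewrite Rmult_assoc, Rinv_l; lra. }
assert (int : forall a b, 0 <= a <= 1 -> 0 <= b <= 1 -> @ex_RInt C_R_CompleteNormedModule g a b).
{ intros a b ha hb; apply ex_RInt_continuous; intros z hz; apply gc.
  unfold Rmin, Rmax in hz; destruct (Rle_dec a b); lra. }
assert (step : forall n, (n <= M)%nat -> Cmod (@RInt C_R_CompleteNormedModule g 0 (INR n / INR M) -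
    RtoC (/ INR M) * prefix_sum n (fun j => g (INR j / INR M)%R))%C <= INR n / INR M * e).
{ induction n as [|n IH]; intros hn.
  - simpl; replace (0 / INR M) with 0 by (unfold Rdiv; ring); rewrite RInt_point.
    change (@zero C_R_CompleteNormedModule) with (RtoC 0).
    replace (RtoC 0 - RtoC (/ INR M) * RtoC 0)%C with (RtoC 0) by ring.
    rewrite Cmod_0; lra.
  - assert (hn' : (n <= M)%nat) by lia; specialize (IH hn').
    assert (fa := frac n hn'); assert (fb := frac (S n) hn).
    set (a := INR n / INR M) in *; set (b := INR (S n) / INR M) in *.
    assert (ba : b = a + / INR M) by (unfold a, b; rewrite S_INR; field; lra).
    rewrite <- (@RInt_Chasles C_R_CompleteNormedModule g 0 a b) by (apply int; lra).
    assert (h : @norm R_AbsRing C_R_NormedModule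
      (@minus C_R_NormedModule (@RInt C_R_CompleteNormedModule g a b) (@scal R_AbsRing C_R_NormedModule (b - a) (g a))) <= (b - a) * e).
    { apply (@norm_RInt_le_const C_R_NormedModule (fun t => @minus C_R_NormedModule (g t) (g a)) a b); [lra| |].
      - intros t ht; rewrite <- Cmod_norm; apply ge; try lra; apply Rabs_le; lra.
      - apply (@is_RInt_minus C_R_NormedModule g (fun _ => g a)).
        + apply (@RInt_correct C_R_CompleteNormedModule); apply int; lra.
        + apply (@is_RInt_const C_R_NormedModule). }
    replace (b - a) with (/ INR M) in h by lra.
    simpl prefix_sum.
    match goal with |- Cmod ?z <= _ => replace z with
      ((@RInt C_R_CompleteNormedModule g 0 a - RtoC (/ INR M) * prefix_sum n (fun j => g (INR j / INR M)%R)) +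
       (@RInt C_R_CompleteNormedModule g a b - RtoC (/ INR M) * g a))%C end.
    + eapply Rle_trans; [apply Cmod_triangle|].
      replace (b * e) with (a * e + / INR M * e) by (rewrite ba; ring).
      apply Rplus_le_compat; [exact IH|].
      eapply Rle_trans; [|exact h].
      right; rewrite <- Cmod_norm, scal_R_Cmult; reflexivity.
    + change (@plus C_R_CompleteNormedModule) with Cplus; fold a; ring. }
specialize (step M (le_n M)).
replace (INR M / INR M) with 1 in step by (field; lra); lra.
Qed.

Lemma riemann_sum_T2 (f : R * R -> C) : (forall z, continuous f z) ->
  forall eps, 0 < eps -> exists M0 : nat, forall M : nat, (M0 <= M)%nat -> (0 < M)%nat ->
  Cmod (integral_T2 f - RtoC (/ INR M) * (RtoC (/ INR M) * prefix_sum M (fun j =>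
    prefix_sum M (fun k => f ((INR j / INR M)%R, (INR k / INR M)%R)))))%C <= eps.
Proof.
intros fc eps eps_gt0; assert (e2 : 0 < eps / 2) by lra.
destruct (uniform_continuity_C f (-1) 2 fc (eps / 2) e2) as [d [d_gt0 H]].
destruct (archimed_cor1 d d_gt0) as [M0 [M0d M0_gt0]].
exists M0; intros M MM M_gt0.
assert (iM : / INR M < d).
{ eapply Rle_lt_trans; [|exact M0d]; apply Rinv_le_contravar; [now apply lt_0_INR|now apply le_INR]. }
assert (MR : 0 < INR M) by now apply lt_0_INR.
set (h := fun x => @RInt C_R_CompleteNormedModule (fun y => f (x, y)) 0 1).
assert (slice : forall x y, @continuous R_UniformSpace C_R_NormedModule (fun y => f (x, y)) y).
{ intros x y; apply (continuous_comp_2 (fun _ => x) (fun y => y) (fun a b => f (a, b))).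
  - apply continuous_const.
  - apply continuous_id.
  - apply (continuous_ext f); [intros [a b]; reflexivity|apply fc]. }
assert (int : forall x, @ex_RInt C_R_CompleteNormedModule (fun y => f (x, y)) 0 1).
{ intros x; apply ex_RInt_continuous; intros z _; apply slice. }
(* The uniform distance of two slices bounds the distance of their integrals, so the modulus of
   continuity of [f] passes to [h]. *)
assert (hd : forall e u v, (forall y, 0 <= y <= 1 -> Cmod (f (u, y) - f (v, y))%C <= e) ->
  Cmod (h u - h v)%C <= e).
{ intros e u v he.
  assert (b : @norm R_AbsRing C_R_NormedModule (@minus C_R_NormedModule (h u) (h v)) <= (1 - 0) * e).
  { apply (@norm_RInt_le_const C_R_NormedModule (fun y => @minus C_R_NormedModule (f (u, y)) (f (v, y))) 0 1); [lra| |].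
    - intros y hy; rewrite <- Cmod_norm; now apply he.
    - apply (@is_RInt_minus C_R_NormedModule); apply (@RInt_correct C_R_CompleteNormedModule); apply int. }
  rewrite <- Cmod_norm in b; rewrite Rminus_0_r, Rmult_1_l in b; exact b. }
assert (hc : forall z, 0 <= z <= 1 -> @continuous R_UniformSpace C_R_NormedModule h z).
{ intros z hz; apply filterlim_locally; intros [e e_gt0].
  destruct (uniform_continuity_C f (-1) 2 fc (e / 2) ltac:(lra)) as [d' [d'_gt0 H']].
  assert (dm : 0 < Rmin d' 1) by (apply Rmin_pos; lra).
  exists (mkposreal _ dm); intros u hu.
  assert (hu' : Rabs (u - z) < Rmin d' 1) by exact hu; simpl in *.
  assert (m1 := Rmin_l d' 1); assert (m2 := Rmin_r d' 1).
  apply norm_compat1; rewrite <- Cmod_norm.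
  apply Rle_lt_trans with (e / 2); [|lra].
  apply hd; intros y hy; apply Rabs_def2 in hu'.
  apply Rlt_le, H'; try lra; [apply Rabs_def1; lra|].
  rewrite Rminus_diag, Rabs_R0; lra. }
assert (frac : forall n, (n < M)%nat -> 0 <= INR n / INR M <= 1).
{ intros n hn; assert (n0 := pos_INR n); assert (hn' := lt_INR _ _ hn); split.
  - apply Rdiv_le_0_compat; lra.
  - apply (Rmult_le_reg_r (INR M)); [lra|]; unfold Rdiv; rewrite Rmult_assoc, Rinv_l; lra. }
assert (r1 := riemann_sum_C h M (eps / 2) M_gt0 hc).
assert (r1' : Cmod (@RInt C_R_CompleteNormedModule h 0 1 -
    RtoC (/ INR M) * prefix_sum M (fun j => h (INR j / INR M)%R))%C <= eps / 2).
{ apply r1; intros u v hu hv huv; apply hd; intros y hy.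
  apply Rlt_le, H; try lra; rewrite Rminus_diag, Rabs_R0; lra. }
assert (r2 : forall x, 0 <= x <= 1 -> Cmod (h x -
    RtoC (/ INR M) * prefix_sum M (fun k => f (x, (INR k / INR M)%R)))%C <= eps / 2).
{ intros x hx; apply (riemann_sum_C (fun y => f (x, y)) M (eps / 2) M_gt0).
  - intros z _; apply slice.
  - intros u v hu hv huv; apply Rlt_le, H; try lra; rewrite Rminus_diag, Rabs_R0; lra. }
assert (r3 : forall n, (n <= M)%nat ->
  Cmod (prefix_sum n (fun j => h (INR j / INR M)%R) - RtoC (/ INR M) * prefix_sum n (fun j =>
    prefix_sum M (fun k => f ((INR j / INR M)%R, (INR k / INR M)%R))))%C <= INR n * (eps / 2)).
{ induction n as [|n IH]; intros hn.
  - simpl; replace (RtoC 0 - RtoC (/ INR M) * RtoC 0)%C with (RtoC 0) by ring; rewrite Cmod_0; lra.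
  - specialize (IH ltac:(lia)); specialize (r2 (INR n / INR M) (frac n ltac:(lia))).
    rewrite S_INR; simpl prefix_sum.
    match type of IH with Cmod ?u <= _ => match type of r2 with Cmod ?v <= _ =>
      match goal with |- Cmod ?z <= _ => replace z with (Cplus u v) by ring end end end.
    eapply Rle_trans; [apply Cmod_triangle|]; lra. }
specialize (r3 M (le_n M)).
assert (r4 : Cmod (RtoC (/ INR M) * (prefix_sum M (fun j => h (INR j / INR M)%R) - RtoC (/ INR M) *
   prefix_sum M (fun j => prefix_sum M (fun k => f ((INR j / INR M)%R, (INR k / INR M)%R)))))%C <= eps / 2).
{ rewrite Cmod_mult, Cmod_R, Rabs_pos_eq by (left; now apply Rinv_0_lt_compat).
  apply (Rmult_le_reg_l (INR M)); [lra|]; rewrite <- Rmult_assoc, Rinv_r by lra; lra. }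
change (integral_T2 f) with (@RInt C_R_CompleteNormedModule h 0 1).
match type of r1' with Cmod ?u <= _ => match type of r4 with Cmod ?v <= _ =>
  match goal with |- Cmod ?z <= _ => replace z with (Cplus u v) by ring end end end.
eapply Rle_trans; [apply Cmod_triangle|]; lra.
Qed.

(** Links the sine form of Korovkin's inequality with the squared chord [|e(x) - e(y)|^2], the form
    that Fejer kernels absorb. *)
Lemma circle_chord_sqr (x y : R) :
  (cos (2 * PI * x) - cos (2 * PI * y)) ^ 2 + (sin (2 * PI * x) - sin (2 * PI * y)) ^ 2 =
  4 * sin (PI * (x - y)) ^ 2.
Proof.
assert (h := cos_2a_sin (PI * (x - y))).
replace (2 * (PI * (x - y))) with (2 * PI * x - 2 * PI * y) in h by ring.
rewrite cos_minus in h.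
assert (h1 := sin2_cos2 (2 * PI * x)); assert (h2 := sin2_cos2 (2 * PI * y)); unfold Rsqr in *.
replace (4 * sin (PI * (x - y)) ^ 2) with
  (2 * (1 - (1 - 2 * sin (PI * (x - y)) * sin (PI * (x - y))))) by ring.
rewrite <- h; lra.
Qed.

Local Close Scope R_scope.

From mathcomp Require Import all_boot all_order all_algebra all_field.
From mathcomp Require Import Rstruct complex ring lra zify.
Import Order.TTheory GRing.Theory Num.Theory.
Local Open Scope ring_scope.

(** * Twisted Kloosterman sums over finite rings *)

(** Its size plays the part of gcd(a, q), which lets the moment argument run in any finite
    commutative ring. *)
Definition annihilator (A : finComUnitRingType) (a : A) : {set A} := [set x | a * x == 0].
Arguments annihilator {A} a%_R.

(** A nonempty solution set is a coset of the annihilator. *)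
Lemma card_linear_le (A : finComUnitRingType) (a c : A) :
  (#|[set x | (a * x == c)%R]| <= #|annihilator a|)%N.
Proof.
have [-> | [x0]] := set_0Vmem [set x | (a * x == c)%R]; first by rewrite cards0.
rewrite inE => /eqP ax0.
rewrite -(card_imset _ (@addrI A (- x0))) subset_leq_card //.
apply/subsetP=> _ /imsetP[x + ->]; rewrite !inE => /eqP ax.
by rewrite mulrDr mulrN ax ax0 addNr.
Qed.

Lemma annihilatorN (A : finComUnitRingType) (a : A) : annihilator (- a) = annihilator a.
Proof. by apply/setP=> x; rewrite !inE mulNr oppr_eq0. Qed.

Lemma card_annihilator_unit (A : finComUnitRingType) (a u : A) :
  u \is a GRing.unit -> #|annihilator (a * u)| = #|annihilator a|.
Proof.
move=> uu; rewrite -(card_imset _ (mulrI uu)); apply: eq_card => x.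
apply/imsetP/idP => [[y] | ]; rewrite inE => /eqP.
  by move=> auy ->; rewrite inE mulrA auy.
move=> ax; exists (u^-1 * x); last by rewrite mulVKr.
by rewrite inE -mulrA mulVKr // ax.
Qed.

(** Multiplication by [b] maps the annihilator of [a * b] into that of [a], with fibres no larger
    than the annihilator of [b]. *)
Lemma card_annihilatorM (A : finComUnitRingType) (a b : A) :
  (#|annihilator (a * b)| <= #|annihilator a| * #|annihilator b|)%N.
Proof.
rewrite -sum1_card (partition_big (fun x => b * x) (mem (annihilator a))) /=; last first.
  by move=> x; rewrite !inE mulrA.
rewrite -sum_nat_const; apply: leq_sum => y _.
rewrite sum1dep_card; apply: leq_trans (card_linear_le A b y).
by rewrite subset_leq_card //; apply/subsetP=> x; rewrite !inE => /andP[].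
Qed.

(** The nesting matches a pair of indices of [second_moment], each index being itself a pair of
    units. *)
Definition inverse_sum_quadruple (A : finComUnitRingType) (z : (A * A) * (A * A)) : bool :=
  [&& (z.1.1 \is a GRing.unit) && (z.1.2 \is a GRing.unit),
      (z.2.1 \is a GRing.unit) && (z.2.2 \is a GRing.unit),
      z.1.1 + z.1.2 == z.2.1 + z.2.2
    & z.1.1^-1 + z.1.2^-1 == z.2.1^-1 + z.2.2^-1].

(* Eliminating [x4] from [x1 + x2 = x3 + x4], [1/x1 + 1/x2 = 1/x3 + 1/x4] leaves
   [(x1 + x2) (x3 - x1) (x3 - x2) = 0]. *)
Lemma inverse_sum_quadruple_eq (A : finComUnitRingType) (x1 x2 x3 x4 : A) :
  inverse_sum_quadruple A ((x1, x2), (x3, x4)) ->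
  2%:R * (x3 - x1) * (x3 - x2) * x3 = (x3 - x1) * (x3 - x2) * ((x3 - x1) + (x3 - x2)).
Proof.
case/and4P => /= /andP[u1 u2] /andP[u3 u4] /eqP s /eqP si.
have e1 : x3 * x4 * (x1 + x2) = x1 * x2 * (x3 + x4).
  have -> : x1 + x2 = x1 * x2 * (x1^-1 + x2^-1).
    by rewrite mulrDr mulrAC divrr // mulrK // mul1r addrC.
  rewrite si mulrCA; congr (_ * _).
  by rewrite mulrDr mulrAC divrr // mulrK // mul1r addrC.
have e4 : x4 = x1 + x2 - x3 by rewrite s addrC addKr.
have : (x3 - x1) * (x3 - x2) * (x1 + x2) = 0.
  rewrite -s e4 in e1; apply/eqP; rewrite -oppr_eq0.
  have -> : - ((x3 - x1) * (x3 - x2) * (x1 + x2)) =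
    x3 * (x1 + x2 - x3) * (x1 + x2) - x1 * x2 * (x1 + x2) by ring.
  by rewrite e1 subrr.
(* Substitute [x1 + x2 = 2 x3 - (x3 - x1) - (x3 - x2)]: for given differences the condition becomes
   linear in [x3]. *)
move=> e; apply/eqP; rewrite -subr_eq0.
have -> : 2%:R * (x3 - x1) * (x3 - x2) * x3 - (x3 - x1) * (x3 - x2) * ((x3 - x1) + (x3 - x2))
  = (x3 - x1) * (x3 - x2) * (x1 + x2) by ring.
by rewrite e.
Qed.

(** A solution is recovered from [v = x3 - x1], [w = x3 - x2] and [x3]. For fixed [v] and [w], the
    possible [x3] solve one linear equation with coefficient [2 v w], so there are at most as many
    as the product of the annihilator sizes of 2, [v] and [w]; the sum over [v] and [w] then
    factors. *)
Lemma card_inverse_sum_quadruple (A : finComUnitRingType) :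
  (#|inverse_sum_quadruple A| <=
   #|annihilator (2%:R : A)| * (\sum_(v : A) #|annihilator v|) ^ 2)%N.
Proof.
pose h (z : (A * A) * (A * A)) := ((z.2.1 - z.1.1, z.2.1 - z.1.2), z.2.1).
pose E := [set y : (A * A) * A | 2%:R * y.1.1 * y.1.2 * y.2 == y.1.1 * y.1.2 * (y.1.1 + y.1.2)].
have hinj : {in inverse_sum_quadruple A &, injective h}.
  case=> [[x1 x2] [x3 x4]] [[y1 y2] [y3 y4]] /and4P[_ _ /= /eqP sx _] /and4P[_ _ /= /eqP sy _].
  case=> e1 e2 e3; rewrite e3 in e1 e2.
  move/addrI/oppr_inj: e1 => e1; move/addrI/oppr_inj: e2 => e2; subst y1 y2 y3.
  by move: sy; rewrite sx => /addrI ->.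
rewrite -(card_in_image hinj).
apply: (@leq_trans #|E|).
  apply: subset_leq_card; apply/subsetP=> _ /imageP[[[x1 x2] [x3 x4]] zP ->].
  by rewrite inE /= (inverse_sum_quadruple_eq _ _ _ _ _ zP).
rewrite -sum1_card (partition_big fst predT) //=.
apply: (@leq_trans (\sum_(vw : A * A)
  #|annihilator (2%:R : A)| * (#|annihilator vw.1| * #|annihilator vw.2|))%N).
  apply: leq_sum => [[v w]] _ /=; rewrite sum1dep_card.
  rewrite mulnA; apply: leq_trans (leq_mul (card_annihilatorM _ _ _) (leqnn _)).
  apply: leq_trans (card_annihilatorM _ _ _).
  apply: leq_trans (card_linear_le A _ (v * w * (v + w))).
  have pinj : injective (pair (v, w) : A -> _) by move=> ? ? [].
  rewrite -(card_imset _ pinj) subset_leq_card //.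
  apply/subsetP=> -[vw x]; rewrite !inE /= => /andP[/eqP e /eqP ?]; subst vw.
  by apply/imsetP; exists x => //; rewrite inE; apply/eqP.
rewrite -big_distrr leq_mul2l; apply/orP; right.
by rewrite -(pair_bigA _ (fun v w => #|annihilator v| * #|annihilator w|)%N) /= expnS expn1 big_distrlr.
Qed.

(** The orthogonality field expresses primitivity: every nonzero [x] has a multiple at which [psi]
    is not 1. *)
Record additive_character (K : numClosedFieldType) (A : finComUnitRingType) (psi : A -> K) : Prop :=
  AdditiveCharacter {
    additive_characterD : forall x y, psi (x + y) = psi x * psi y;
    additive_character_norm : forall x, `|psi x| = 1;
    additive_character_orth : forall x, x != 0 -> \sum_a psi (a * x) = 0 }.

Lemma additive_character0 (K : numClosedFieldType) (A : finComUnitRingType) (psi : A -> K) :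
  additive_character K A psi -> psi 0 = 1.
Proof.
move=> ch; have n0 : psi 0 != 0 by rewrite -normr_eq0 (additive_character_norm _ _ _ ch) oner_neq0.
by apply: (mulfI n0); rewrite -(additive_characterD _ _ _ ch) addr0 mulr1.
Qed.

Lemma additive_characterB (K : numClosedFieldType) (A : finComUnitRingType) (psi : A -> K) x y :
  additive_character K A psi -> psi x * (psi y)^* = psi (x - y).
Proof.
move=> ch; have n0 : psi y != 0 by rewrite -normr_eq0 (additive_character_norm _ _ _ ch) oner_neq0.
apply: (mulIf n0); rewrite -(additive_characterD _ _ _ ch) subrK -mulrA [_^* * _]mulrC -normCK.
by rewrite (additive_character_norm _ _ _ ch) expr1n mulr1.
Qed.

Lemma additive_character_sum (K : numClosedFieldType) (A : finComUnitRingType) (psi : A -> K) x :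
  additive_character K A psi -> \sum_a psi (a * x) = (if x == 0 then #|A|%:R else 0).
Proof.
move=> ch; case: eqP => [-> | /eqP xn0]; last exact: (additive_character_orth _ _ _ ch).
under eq_bigr do rewrite mulr0 (additive_character0 _ _ _ ch).
by rewrite sumr_const.
Qed.

(** Expanding the square and summing over [a] and [b], orthogonality keeps only the pairs with equal
    [s] and equal [t], each of weight at most [#|A| ^ 2]. The index type is abstract because it will
    consist of pairs of units. *)
Lemma second_moment (K : numClosedFieldType) (A : finComUnitRingType) (psi : A -> K)
    (I : finType) (P : pred I) (w : I -> K) (s t : I -> A) :
  additive_character K A psi -> (forall i, P i -> `|w i| <= 1) ->
  \sum_a \sum_b `|\sum_(i | P i) w i * psi (a * s i + b * t i)| ^+ 2 <=
  #|A|%:R ^+ 2 * #|[pred ij : I * I | [&& P ij.1, P ij.2, s ij.1 == s ij.2 & t ij.1 == t ij.2]]|%:R.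
Proof.
move=> ch wle.
set lhs := \sum_a _; have lhs_ge0 : 0 <= lhs.
  by apply: sumr_ge0 => a _; apply: sumr_ge0 => b _; apply: exprn_ge0.
have lhsE : lhs =
    \sum_(i | P i) \sum_(j | P j) (w i * (w j)^*) *
       ((\sum_a psi (a * (s i - s j))) * (\sum_b psi (b * (t i - t j)))).
  transitivity (\sum_a \sum_b \sum_(i | P i) \sum_(j | P j) (w i * (w j)^*) *
       (psi (a * (s i - s j)) * psi (b * (t i - t j)))).
    apply: eq_bigr => a _; apply: eq_bigr => b _; rewrite normCK rmorph_sum big_distrlr /=.
    apply: eq_bigr => i _; apply: eq_bigr => j _.
    rewrite rmorphM mulrACA (additive_characterB _ _ _ _ _ ch) -(additive_characterD _ _ _ ch).
    by congr (_ * psi _); ring.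
  under eq_bigr do rewrite exchange_big.
  rewrite exchange_big; apply: eq_bigr => i _.
  under eq_bigr do rewrite exchange_big.
  rewrite exchange_big; apply: eq_bigr => j _.
  under eq_bigr do rewrite -mulr_sumr.
  rewrite -mulr_sumr; congr (_ * _).
  by rewrite big_distrlr.
have -> : #|A|%:R ^+ 2 * #|[pred ij : I * I | [&& P ij.1, P ij.2, s ij.1 == s ij.2 & t ij.1 == t ij.2]]|%:R
  = \sum_(i | P i) \sum_(j | P j) (if (s i == s j) && (t i == t j) then #|A|%:R ^+ 2 else 0) :> K.
  rewrite pair_big /= -big_mkcondr /= mulr_natr -sumr_const.
  by apply: eq_bigl => -[i j]; rewrite inE /= -!andbA.
rewrite -(ger0_norm lhs_ge0) lhsE.
apply: le_trans (ler_norm_sum _ _ _) _; apply: ler_sum => i Pi.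
apply: le_trans (ler_norm_sum _ _ _) _; apply: ler_sum => j Pj.
rewrite !(additive_character_sum _ _ _ _ ch) !subr_eq0.
case: (s i == s j); last by rewrite mul0r mulr0 normr0.
case: (t i == t j); last by rewrite !mulr0 normr0.
rewrite normrM normrM norm_conjC -expr2 normrX normr_nat ler_piMl ?exprn_ge0 ?ler0n //.
by rewrite mulr_ile1 ?wle.
Qed.

Definition unit_multiplicative (K : numClosedFieldType) (A : finComUnitRingType) (chi : A -> K) : Prop :=
  [/\ forall x y, x \is a GRing.unit -> y \is a GRing.unit -> chi (x * y) = chi x * chi y
    & forall x, x \is a GRing.unit -> `|chi x| = 1].

Definition twisted_kloosterman (K : numClosedFieldType) (A : finComUnitRingType)
    (psi chi : A -> K) (a b : A) : K :=
  \sum_(x | x \is a GRing.unit) chi x * psi (a * x + b * x^-1).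

(** The substitution [x -> u x] only pulls out [chi u], of modulus 1. *)
Lemma twisted_kloosterman_orbit (K : numClosedFieldType) (A : finComUnitRingType)
    (psi chi : A -> K) (a b u : A) :
  unit_multiplicative K A chi -> u \is a GRing.unit ->
  `|twisted_kloosterman K A psi chi (a * u) (b * u^-1)| = `|twisted_kloosterman K A psi chi a b|.
Proof.
case=> chiM chi1 uu.
rewrite -[LHS]mul1r -(chi1 u uu) -normrM; congr `|_|.
rewrite /twisted_kloosterman mulr_sumr [RHS](reindex_inj (mulrI uu)) /=.
apply: eq_big => [x | x]; first by rewrite unitrMr.
by move=> ux; rewrite mulrA chiM // invrM // [x^-1 * _]mulrC !mulrA.
Qed.

(** Under [x -> x^-1] the coefficients trade places, so a bound governed by the annihilator of [a]
    also yields one governed by that of [b]. *)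
Lemma twisted_kloosterman_swap (K : numClosedFieldType) (A : finComUnitRingType)
    (psi chi : A -> K) (a b : A) :
  twisted_kloosterman K A psi chi a b = twisted_kloosterman K A psi (fun x => chi x^-1) b a.
Proof.
rewrite /twisted_kloosterman (reindex_inj (@invr_inj A)) /=.
by apply: eq_big => [x | x _]; rewrite ?unitrV // invrK addrC.
Qed.

(** The square of the sum is again an exponential sum, over pairs of units with phases [x + y] and
    [1/x + 1/y]; its second moment counts [inverse_sum_quadruple]. *)
Lemma twisted_kloosterman_moment (K : numClosedFieldType) (A : finComUnitRingType)
    (psi chi : A -> K) :
  additive_character K A psi -> unit_multiplicative K A chi ->
  \sum_a \sum_b `|twisted_kloosterman K A psi chi a b| ^+ 4 <=
  #|A|%:R ^+ 2 * (#|annihilator (2%:R : A)| * (\sum_(v : A) #|annihilator v|) ^ 2)%N%:R.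
Proof.
move=> ch [chiM chi1].
pose P (i : A * A) := (i.1 \is a GRing.unit) && (i.2 \is a GRing.unit).
have := second_moment K A psi (A * A)%type P (fun i => chi i.1 * chi i.2)
  (fun i => i.1 + i.2) (fun i => i.1^-1 + i.2^-1) ch.
have wle : forall i, P i -> `|chi i.1 * chi i.2| <= 1.
  by move=> i /andP[u1 u2]; rewrite normrM !chi1 // mulr1.
move/(_ wle) => le2; apply: le_trans (le_trans le2 _).
  rewrite le_eqVlt; apply/orP; left; apply/eqP.
  apply: eq_bigr => a _; apply: eq_bigr => b _.
  rewrite (exprM _ 2 2) -normrX; congr (`|_| ^+ 2).
  rewrite expr2 big_distrlr pair_big /=; apply: eq_bigr => -[x y] _ /=.
  rewrite mulrACA -(additive_characterD _ _ _ ch); congr (_ * psi _); ring.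
rewrite ler_wpM2l ?exprn_ge0 ?ler0n // ler_nat.
apply: leq_trans (card_inverse_sum_quadruple A).
by apply: eq_leq; apply: eq_card => z; rewrite !inE /inverse_sum_quadruple -!andbA.
Qed.

(** Every unit [u] gives an entry [(a u, b / u)] of the fourth moment equal to the one at [(a, b)].
    Grouping by [c = a u], at most [m] units share the same [c], and each of their entries is
    bounded by the whole row of [c]. *)
Lemma twisted_kloosterman_bound_left (K : numClosedFieldType) (A : finComUnitRingType)
    (psi chi : A -> K) (a b : A) (m : nat) :
  additive_character K A psi -> unit_multiplicative K A chi -> (#|annihilator a| <= m)%N ->
  #|[pred x : A | x \is a GRing.unit]|%:R * `|twisted_kloosterman K A psi chi a b| ^+ 4 <=
  (m * #|A| ^ 2 * (#|annihilator (2%:R : A)| * (\sum_(v : A) #|annihilator v|) ^ 2))%N%:R.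
Proof.
move=> ch chiP am.
rewrite -mulnA natrM; apply: le_trans (_ : _ <= m%:R *
  \sum_a \sum_b `|twisted_kloosterman K A psi chi a b| ^+ 4) _; last first.
  rewrite ler_wpM2l ?ler0n // natrM natrX; exact: twisted_kloosterman_moment.
rewrite mulrC mulr_natr -sumr_const.
rewrite (eq_bigr (fun u => `|twisted_kloosterman K A psi chi (a * u) (b * u^-1)| ^+ 4)); last first.
  by move=> u uu; rewrite twisted_kloosterman_orbit.
rewrite (partition_big (fun u => a * u) predT) //= mulr_sumr.
apply: ler_sum => c _.
apply: le_trans (_ : _ <= \sum_(u | (u \is a GRing.unit) && (a * u == c))
   \sum_d `|twisted_kloosterman K A psi chi c d| ^+ 4) _.
  apply: ler_sum => u /andP[uu /eqP <-].
  rewrite (bigD1 (b * u^-1)) //= lerDl; apply: sumr_ge0 => d _; exact: exprn_ge0.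
rewrite sumr_const -[X in X <= _]mulr_natl ler_wpM2r ?sumr_ge0 // => [d _|]; first exact: exprn_ge0.
rewrite ler_nat; apply: leq_trans am; apply: leq_trans (card_linear_le A a c).
by rewrite subset_leq_card //; apply/subsetP=> x; rewrite !inE => /andP[].
Qed.

Lemma twisted_kloosterman_bound (K : numClosedFieldType) (A : finComUnitRingType)
    (psi chi : A -> K) (a b : A) (m : nat) :
  additive_character K A psi -> unit_multiplicative K A chi ->
  (#|annihilator a| <= m)%N || (#|annihilator b| <= m)%N ->
  #|[pred x : A | x \is a GRing.unit]|%:R * `|twisted_kloosterman K A psi chi a b| ^+ 4 <=
  (m * #|A| ^ 2 * (#|annihilator (2%:R : A)| * (\sum_(v : A) #|annihilator v|) ^ 2))%N%:R.
Proof.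
move=> ch chiP /orP[am | bm]; first exact: twisted_kloosterman_bound_left.
rewrite twisted_kloosterman_swap; apply: twisted_kloosterman_bound_left => //.
by case: chiP => chiM chi1; split=> [x y ux uy | x ux]; rewrite ?invrM ?chi1 ?chiM ?unitrV // mulrC.
Qed.

Lemma sum_unit_character0 (K : numClosedFieldType) (A : finComUnitRingType) (chi : A -> K) (u : A) :
  unit_multiplicative K A chi -> u \is a GRing.unit -> chi u != 1 ->
  \sum_(x | x \is a GRing.unit) chi x = 0.
Proof.
case=> chiM _ uu chiu; set s := \sum_(x | _) _.
have : s = chi u * s.
  rewrite /s mulr_sumr [LHS](reindex_inj (mulrI uu)) /=.
  by apply: eq_big => [x | x]; rewrite unitrMr // => ux; rewrite chiM.
move/eqP; rewrite -subr_eq0 -{1}[s]mul1r -mulrBl mulf_eq0 subr_eq0 eq_sym (negPf chiu) /=.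
by move/eqP.
Qed.

(** * Arithmetic bounds and the rings Z/q *)

Lemma size_divisors (n : nat) :
  (0 < n)%N -> size (divisors n) = (\prod_(p <- primes n) (logn p n).+1)%N.
Proof.
move=> n_gt0.
have -> : (\prod_(p <- primes n) (logn p n).+1)%N = (\prod_(f <- prime_decomp n) f.2.+1)%N.
  by rewrite prime_decompE big_map.
rewrite /divisors unlock; elim: (prime_decomp n) => //= -[p e] s /= <-.
rewrite /PrimeDecompAux.add_divisors; set l := foldr _ _ _ => /=.
set g := fun _ => _.
(* Each round of [g] merges [p] times the current list into the original one, so it adds [size l]
   entries to the count. *)
suff -> : forall k, size (iter k g l) = (k.+1 * size l)%N by [].
elim=> [|k IHk]; first by rewrite mul1n.
by rewrite iterS {1}/g size_merge size_cat size_map IHk [RHS]mulSn addnC.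
Qed.

Lemma leq_exp_mul (c d m n k : nat) : (c * m <= d * n -> c ^ k * m ^ k <= d ^ k * n ^ k)%N.
Proof. by move=> le_mn; rewrite -!expnMn; case: k => // k; rewrite leq_exp2r. Qed.

(** The local factor at [p ^ a] of [n ^ 9 d(n) ^ 4 <= C phi(n) ^ 10], after cancelling powers of
    [p]. From 64 on no constant is lost, because [(p / (p - 1)) ^ 10 <= 2] and
    [2 (a + 1) ^ 4 <= 64 ^ a]. *)
Lemma prime_power_bound_large (p a : nat) :
  (64 <= p)%N -> (0 < a)%N -> (a.+1 ^ 4 * p ^ 10 <= p.-1 ^ 10 * p ^ a)%N.
Proof.
move=> p_ge; case: a => // a _.
have p_le : (p ^ 10 <= 2 * p.-1 ^ 10)%N.
  have : (63 ^ 10 * p ^ 10 <= 64 ^ 10 * p.-1 ^ 10)%N by apply: leq_exp_mul; lia.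
  have : (0 < 63 ^ 10)%N by rewrite expn_gt0.
  have : (64 ^ 10 <= 2 * 63 ^ 10)%N by lia.
  move: (63 ^ 10)%N (64 ^ 10)%N => c d d_le c_gt0 le1.
  rewrite -(@leq_pmul2l c) // mulnA [(c * 2)%N]mulnC.
  by apply: leq_trans le1 _; rewrite leq_mul2r d_le orbT.
have a_le : (a.+2 ^ 4 * 2 <= 64 ^ a.+1)%N.
  elim: a => [|a IH]; first by lia.
  have h : (a.+3 ^ 4 <= 16 * a.+2 ^ 4)%N by rewrite -(expnMn 2 _ 4) leq_exp2r; lia.
  by rewrite [(64 ^ a.+2)%N]expnS; lia.
have pa_le : (64 ^ a.+1 <= p ^ a.+1)%N by rewrite leq_exp2r.
apply: leq_trans (_ : a.+2 ^ 4 * (2 * p.-1 ^ 10) <= _)%N; first by rewrite leq_mul2l p_le orbT.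
by rewrite mulnA mulnC leq_mul2l (leq_trans a_le pa_le) orbT.
Qed.

Lemma expn4_le_exp2 (a : nat) : (a.+1 ^ 4 <= 2 ^ 6 * 2 ^ a)%N.
Proof.
(* Direct check up to [a = 6]; beyond that, one step multiplies the left side by at most
   [(8 / 7) ^ 4 < 2]. *)
do 6 (case: a => [|a]; first lia).
elim: a => [|a IH]; first lia.
have h : (a.+3.+4.+1 ^ 4 <= 2 * a.+3.+4 ^ 4)%N.
  have : (7 ^ 4 * a.+3.+4.+1 ^ 4 <= 8 ^ 4 * a.+3.+4 ^ 4)%N by apply: leq_exp_mul; lia.
  by lia.
by rewrite [X in (_ <= _ * X)%N]expnS; lia.
Qed.

(** Small primes cost a constant: [p <= 2 (p - 1)] accounts for [2 ^ 10], and [expn4_le_exp2] for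
    [2 ^ 6]. *)
Lemma prime_power_bound (p a : nat) :
  (1 < p)%N -> (a.+1 ^ 4 * p ^ 10 <= 2 ^ 16 * (p.-1 ^ 10 * p ^ a))%N.
Proof.
move=> p_gt1.
have p_le : (p ^ 10 <= 2 ^ 10 * p.-1 ^ 10)%N by rewrite -expnMn leq_exp2r //; lia.
have pa_le : (2 ^ a <= p ^ a)%N by case: a => // a; rewrite leq_exp2r.
have a_le : (a.+1 ^ 4 <= 2 ^ 6 * p ^ a)%N.
  by apply: leq_trans (expn4_le_exp2 a) _; rewrite leq_mul2l pa_le orbT.
apply: leq_trans (leq_mul a_le p_le) _.
by rewrite mulnACA -expnD [(p ^ a * _)%N]mulnC.
Qed.

(** The exponents are those of [kloosterman_Zp_bound]: squaring the fourth-moment bound leaves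
    [q ^ 8 d(q) ^ 4], and one further factor [q] is the saving. The inequality is multiplicative in
    [n], with local constant 1 at primes from 64 on. *)
Lemma totient_divisors_bound :
  exists2 C : nat, (0 < C)%N & forall n, (0 < n)%N ->
    (n ^ 9 * size (divisors n) ^ 4 <= C * totient n ^ 10)%N.
Proof.
pose B := (2 ^ 16)%N; have B_gt0 : (0 < B)%N by rewrite expn_gt0.
exists (B ^ 64)%N => [|n n_gt0]; first by rewrite expn_gt0 B_gt0.
have nE : n = (\prod_(p <- primes n) p ^ logn p n)%N.
  by rewrite {1}(prod_prime_decomp n_gt0) prime_decompE big_map.
apply: (@leq_trans ((\prod_(p <- primes n) (if p < 64 then B else 1)) * totient n ^ 10))%N.
  rewrite size_divisors // totientE // {1}nE.
  rewrite !(big_morph (expn^~ _) (fun x y => expnMn x y _) (exp1n _)) -!big_split /=.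
  rewrite [X in (X <= _)%N]big_seq [X in (_ <= X)%N]big_seq.
  apply: (big_ind2 leq) => // [x1 x2 y1 y2 | p]; first exact: leq_mul.
  rewrite mem_primes => /and3P[p_pr _ p_dv].
  have a_gt0 : (0 < logn p n)%N by rewrite logn_gt0 mem_primes p_pr n_gt0.
  case: (logn p n) a_gt0 => // a _ /=.
  have p_gt0 := prime_gt0 p_pr.
  have key : (a.+2 ^ 4 * p ^ 10 <= (if p < 64 then B else 1) * (p.-1 ^ 10 * p ^ a.+1))%N.
    case: ltnP => p64; first exact: prime_power_bound (prime_gt1 p_pr).
    by rewrite mul1n; apply: prime_power_bound_large.
  rewrite -(@leq_pmul2r (p ^ 10)%N) ?expn_gt0 ?p_gt0 //.
  rewrite -mulnA -[X in (_ <= X)%N]mulnA expnMn -[X in (_ <= _ * X)%N]mulnA -expnMn -expnSr.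
  rewrite -!expnM; apply: leq_trans (leq_mul (leqnn _) key) _.
  rewrite mulnCA leq_mul2l; apply/orP; right.
  by rewrite mulnCA leq_mul2l -expnD -(mulnSr a.+1 9) leqnn orbT.
rewrite leq_mul2r; apply/orP; right.
(* The constant [B ^ 64] comes from the crude count of at most 64 primes below 64. *)
rewrite -big_mkcond /= big_const_seq iter_muln_1 leq_pexp2l // -size_filter -(size_iota 0 64).
apply: uniq_leq_size; first by rewrite filter_uniq // primes_uniq.
by move=> p; rewrite mem_filter mem_iota => /andP[].
Qed.

(** If [k y = 0] in Z/q, the quotient [k y / q], a natural number below [k], determines [y]. *)
Lemma card_annihilator_nat (q k : nat) :
  (1 < q)%N -> (0 < k)%N -> (#|annihilator (k%:R : 'Z_q)| <= k)%N.
Proof.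
move=> q_gt1 k_gt0.
have lt y : (y < q)%N -> (k * y %/ q < k)%N by move=> yq; rewrite ltn_divLR ?(ltnW q_gt1) // ltn_mul2l k_gt0.
have yq (y : 'Z_q) : (y < q)%N by rewrite -[X in (_ < X)%N](Zp_cast q_gt1) ltn_ord.
pose h (y : 'Z_q) : 'I_k := Ordinal (lt _ (yq y)).
rewrite -[X in (_ <= X)%N]card_ord -(@card_in_imset _ _ h).
  exact: max_card.
have annE (y : 'Z_q) : y \in annihilator (k%:R : 'Z_q) -> (k * y = k * y %/ q * q)%N.
  rewrite inE -[in k%:R * y](natr_Zp y) -natrM => /eqP/(congr1 val) /=.
  rewrite val_Zp_nat // => e; apply/esym/divnK; exact/eqP.
move=> x y /annE ex /annE ey [] hxy; apply: val_inj => /=; apply/eqP.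
by rewrite -(eqn_pmul2l k_gt0) ex ey hxy.
Qed.

(** By Bezout the gcd is a multiple of [v] modulo [q], so whatever [v] kills, the gcd kills too. *)
Lemma card_annihilator_gcd (q : nat) (v : 'Z_q) :
  (1 < q)%N -> (#|annihilator v| <= gcdn v q)%N.
Proof.
move=> q_gt1; have q_gt0 := ltnW q_gt1.
have g_gt0 : (0 < gcdn v q)%N by rewrite gcdn_gt0 q_gt0 orbT.
apply: leq_trans (card_annihilator_nat q _ q_gt1 g_gt0).
apply: subset_leq_card; apply/subsetP=> y; rewrite !inE => /eqP vy.
have [a _ /dvdnP[b e]] := @Bezoutr v q q_gt0.
have : (gcdn v q + a * v)%:R = 0 :> 'Z_q.
  by rewrite e natrM [q%:R](_ : _ = 0) ?mulr0 //; apply: val_inj; rewrite /= val_Zp_nat // modnn.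
rewrite natrD natrM natr_Zp => /eqP; rewrite addr_eq0 => /eqP ->.
by rewrite mulNr -mulrA vy mulr0 oppr0.
Qed.

(** The gcd is bounded by the sum of all common divisors; after exchanging sums, each divisor [d] of
    [q] contributes at most [d] times [q / d]. *)
Lemma sum_gcdn_le (q : nat) : (0 < q)%N -> (\sum_(v < q) gcdn v q <= q * size (divisors q))%N.
Proof.
move=> q_gt0.
have cnt d : (d %| q)%N -> (#|[pred v : 'I_q | (d %| v)%N]| <= q %/ d)%N.
  move=> dq; have d_gt0 := dvdn_gt0 q_gt0 dq.
  have lt (v : 'I_q) : (v %/ d < q %/ d)%N by rewrite ltn_divLR // divnK.
  pose h (v : 'I_q) := Ordinal (lt v).
  rewrite -[X in (_ <= X)%N]card_ord -(@card_in_image _ _ h); first exact: max_card.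
  move=> x y; rewrite !inE => dx dy [] e; apply: val_inj => /=.
  by rewrite -(divnK dx) e divnK.
rewrite (leq_trans (_ : _ <= \sum_(v < q) \sum_(d <- divisors q | (d %| v)%N) d)%N) //.
  apply: leq_sum => v _.
  rewrite (big_rem (gcdn v q)) /=; last by rewrite -dvdn_divisors // dvdn_gcdr.
  by rewrite dvdn_gcdl leq_addr.
rewrite (exchange_big_dep predT) //= mulnC -sum1_size big_distrl /=.
rewrite big_seq [X in (_ <= X)%N]big_seq; apply: leq_sum => d.
rewrite -dvdn_divisors // => dq; rewrite mul1n sum_nat_const.
by apply: leq_trans (leq_mul (cnt d dq) (leqnn d)) _; rewrite divnK.
Qed.

Lemma card_unit_Zp (q : nat) : (1 < q)%N -> #|[pred x : 'Z_q | x \is a GRing.unit]| = totient q.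
Proof.
move=> q_gt1; rewrite totient_count_coprime -sum1_card big_mkcond /=.
rewrite -[X in \sum_(0 <= _ < X) _](Zp_cast q_gt1) big_mkord; apply: eq_bigr => i _.
by rewrite inE -[i in i \is a _]natr_Zp unitZpE //; case: coprime.
Qed.

(** A saving of [q ^ (1/8)] for the normalised sum, written with integer powers. [C] is chosen
    before the modulus, the characters and the coefficients, which is the uniformity that the limits
    need; [m] carries the dependence on the frequencies. *)
Lemma kloosterman_Zp_bound :
  exists2 C : nat, (0 < C)%N & forall (K : numClosedFieldType) (q : nat) (psi chi : 'Z_q -> K)
    (a b : 'Z_q) (m : nat),
  (1 < q)%N -> additive_character K 'Z_q psi -> unit_multiplicative K 'Z_q chi ->
  (#|annihilator a| <= m)%N || (#|annihilator b| <= m)%N ->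
  q%:R * `|(totient q)%:R^-1 * twisted_kloosterman K 'Z_q psi chi a b| ^+ 8 <= (C * m ^ 2)%N%:R.
Proof.
have [C C_gt0 CP] := totient_divisors_bound; exists (4 * C)%N; first by rewrite muln_gt0.
move=> K q psi chi a b m q_gt1 ch chiP abm; have q_gt0 := ltnW q_gt1.
have := twisted_kloosterman_bound K 'Z_q psi chi a b m ch chiP abm.
rewrite card_unit_Zp //; set S := `|_| => le1.
have phi_gt0 : (0 < totient q)%N by rewrite totient_gt0.
have cardZ : #|'Z_q| = q by rewrite card_ord Zp_cast.
set phi := totient q in le1 phi_gt0 *; set d := size (divisors q).
have le2 : phi%:R * S ^+ 4 <= (m * q ^ 2 * (2 * (q * d) ^ 2))%N%:R :> K.
  apply: le_trans le1 _; rewrite ler_nat cardZ leq_mul2l; apply/orP; right.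
  apply: leq_mul; first exact: card_annihilator_nat.
  rewrite leq_exp2r //; apply: leq_trans (sum_gcdn_le q q_gt0).
  rewrite -(big_mkord predT (gcdn^~ q)) -[X in (_ <= \sum_(0 <= _ < X) _)%N](Zp_cast q_gt1).
  rewrite big_mkord; apply: leq_sum => v _.
  exact: card_annihilator_gcd.
have S_ge0 : 0 <= S by apply: normr_ge0.
have le3 : phi%:R ^+ 2 * S ^+ 8 <= (4 * m ^ 2 * (q ^ 8 * d ^ 4))%N%:R :> K.
  rewrite (exprM S 4 2) -exprMn.
  have -> : (4 * m ^ 2 * (q ^ 8 * d ^ 4) = (m * q ^ 2 * (2 * (q * d) ^ 2)) ^ 2)%N by ring.
  by rewrite natrX lerXn2r // nnegrE ?ler0n // mulr_ge0 ?ler0n ?exprn_ge0.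
have le4 : phi%:R ^+ 10 * (q%:R * S ^+ 8) <= (4 * m ^ 2 * C)%N%:R * phi%:R ^+ 10 * phi%:R ^+ 8 :> K.
  have -> : phi%:R ^+ 10 * (q%:R * S ^+ 8) = phi%:R ^+ 8 * q%:R * (phi%:R ^+ 2 * S ^+ 8) :> K by ring.
  apply: le_trans (ler_wpM2l _ le3) _; first by rewrite mulr_ge0 ?exprn_ge0 ?ler0n.
  have := CP q q_gt0; rewrite -(ler_nat K) -/d -/phi => le5.
  have -> : phi%:R ^+ 8 * q%:R * (4 * m ^ 2 * (q ^ 8 * d ^ 4))%N%:R =
     (phi%:R ^+ 8 * (4 * m ^ 2)%N%:R) * (q ^ 9 * d ^ 4)%N%:R :> K.
    by rewrite !natrM; ring.
  apply: le_trans (ler_wpM2l _ le5) _; first by rewrite mulr_ge0 ?exprn_ge0 ?ler0n.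
  by rewrite le_eqVlt; apply/orP; left; apply/eqP; rewrite !natrM; ring.
have phiR : 0 < phi%:R :> K by rewrite ltr0n.
rewrite normrM normfV normr_nat -/S exprMn exprVn mulrCA ler_pdivrMl ?exprn_gt0 //.
rewrite -(@ler_pM2l _ (phi%:R ^+ 10)) ?exprn_gt0 //; apply: le_trans le4 _.
by rewrite le_eqVlt; apply/orP; left; apply/eqP; rewrite !natrM; ring.
Qed.

(** * Quadratic characters of finite fields *)

Definition qchar (F : finFieldType) (x : F) : int :=
  if x == 0 then 0 else if [exists y, y * y == x] then 1 else -1.

Lemma qcharP (F : finFieldType) (x : F) : x != 0 -> qchar F x = 1 \/ qchar F x = -1.
Proof. by rewrite /qchar => /negPf ->; case: ifP; [left | right]. Qed.

(** The case that needs an idea is a power equal to 1: a square root [s] of [x] in an algebraic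
    closure then satisfies [s ^ #|F| = s], so it is a root of [X ^ #|F| - X], whose roots are
    exactly the elements of [F]. *)
Lemma euler_criterion (F : finFieldType) (x : F) :
  odd #|F| -> 2%:R != 0 :> F -> (qchar F x)%:~R = x ^+ #|F|./2.
Proof.
move=> oF two_n0; have F_gt1 := finNzRing_gt1 F.
have oE : #|F| = #|F|./2.*2.+1 by rewrite -[LHS]odd_double_half oF.
rewrite /qchar; case: eqP => [-> | /eqP x_n0].
  by rewrite expr0n; case: #|F|./2 oE F_gt1 => // ->.
have x_sq : (x ^+ #|F|./2) ^+ 2 = 1.
  apply: (mulfI x_n0); rewrite mulr1 -exprM muln2 -exprS -oE; exact: expf_card.
case: existsP => [[y /eqP yE] | no_root].
  have y_n0 : y != 0 by apply: contraNneq x_n0 => y0; rewrite -yE y0 mul0r.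
  apply: (mulfI y_n0); rewrite mulr1 -yE -expr2 -exprM mul2n -exprS -oE.
  by rewrite expf_card.
have := x_sq; move/eqP; rewrite sqrf_eq1 => /orP[/eqP x1 | /eqP -> //].
case: no_root.
have [K [FtoK _]] := countable_algebraic_closure F.
have [s sE] := @solve_monicpoly K 2 (fun i => if i == 0%N then FtoK x else 0) isT.
rewrite !big_ord_recl big_ord0 /= mul0r !addr0 expr0 mulr1 in sE.
have : root (map_poly FtoK ('X^#|F| - 'X)) s.
  rewrite rmorphB rmorphXn /= map_polyX rootE hornerD hornerN hornerXn hornerX.
  rewrite [in s ^+ _]oE exprS -mul2n exprM sE -rmorphXn x1 rmorph1 mulr1 subrr //.
rewrite finField_genPoly rmorph_prod /=.
under eq_bigr do rewrite rmorphB /= map_polyX map_polyC /=.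
rewrite -big_enum /= -(big_map FtoK predT (fun z => 'X - z%:P)) root_prod_XsubC.
case/mapP=> y _ sy; exists y; apply/eqP/(fmorph_inj FtoK).
by rewrite rmorphM -sy -sE.
Qed.

(** Symbol identities are proved in a field where 2 is nonzero and read back in the integers through
    this injectivity. *)
Lemma intr_pm1_inj (F : fieldType) (m n : int) : 2%:R != 0 :> F ->
  m \in [:: 0; 1; -1] -> n \in [:: 0; 1; -1] -> m%:~R = n%:~R :> F -> m = n.
Proof.
move=> two_n0; have one_n0 := oner_neq0 F.
have h0 (k : int) : k \in [:: 1; -1] -> (k%:~R : F) != 0.
  by rewrite !inE => /orP[] /eqP ->; rewrite ?rmorphN ?oppr_eq0.
rewrite !inE => /or3P[] /eqP -> /or3P[] /eqP -> // /eqP; rewrite ?rmorph0 ?rmorphN ?rmorph1.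
- by rewrite eq_sym (negPf one_n0).
- by rewrite eq_sym oppr_eq0 (negPf one_n0).
- by rewrite (negPf one_n0).
- by rewrite -addr_eq0 (negPf two_n0).
- by rewrite oppr_eq0 (negPf one_n0).
- by rewrite eq_sym -addr_eq0 (negPf two_n0).
Qed.

Lemma qchar_mem (F : finFieldType) (x : F) : qchar F x \in [:: 0; 1; -1].
Proof. by rewrite /qchar; case: eqP => // _; case: ifP. Qed.

Lemma intr_qchar_inj (F : finFieldType) (K : fieldType) (m : int) (x : F) : 2%:R != 0 :> K ->
  m \in [:: 0; 1; -1] -> (qchar F x)%:~R = m%:~R :> K -> qchar F x = m.
Proof. by move=> ? ? ; apply: intr_pm1_inj => //; apply: qchar_mem. Qed.

Lemma qchar0 (F : finFieldType) : qchar F 0 = 0.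
Proof. by rewrite /qchar eqxx. Qed.

Lemma pm1M (m n : int) : m \in [:: 0; 1; -1] -> n \in [:: 0; 1; -1] -> m * n \in [:: 0; 1; -1].
Proof. by rewrite !inE => /or3P[] /eqP -> /or3P[] /eqP ->. Qed.

Lemma qcharM (F : finFieldType) (x y : F) : odd #|F| -> 2%:R != 0 :> F ->
  qchar F (x * y) = qchar F x * qchar F y.
Proof.
move=> oF two_n0; apply: (intr_pm1_inj F) => //; rewrite ?pm1M ?qchar_mem //.
by rewrite intrM !euler_criterion // exprMn.
Qed.

Lemma qchar_sqr (F : finFieldType) (x : F) : x != 0 -> qchar F (x * x) = 1.
Proof.
by move=> x_n0; rewrite /qchar mulf_eq0 orbb (negPf x_n0); case: existsP => // -[]; exists x.
Qed.

Lemma qchar1 (F : finFieldType) : qchar F 1 = 1.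
Proof. by have := qchar_sqr F 1 (oner_neq0 F); rewrite mulr1. Qed.

(** If every element were a square, squaring would be a surjection of a finite set, hence injective,
    although 1 and -1 have the same square. *)
Lemma qchar_nonresidue (F : finFieldType) : 2%:R != 0 :> F -> exists x : F, qchar F x = -1.
Proof.
move=> two_n0; pose sq (y : F) := y * y.
have [/forallP surj | /forallPn[x xP]] := boolP [forall x, [exists y, sq y == x]].
  have oim : #|codom sq| = #|F|.
    apply: eq_card => x; apply/codomP; have /existsP[y /eqP <-] := surj x; by exists y.
  have : injective sq by apply/injectiveP; rewrite /injectiveb /dinjectiveb; apply/card_uniqP; rewrite oim size_codom.
  move=> inj; have : (1 : F) = -1 by apply: inj; rewrite /sq mulrNN.
  by move/eqP; rewrite -addr_eq0 (negPf two_n0).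
exists x; rewrite /qchar (negPf xP); case: eqP xP => // ->.
by case/existsP; exists 0; rewrite /sq mulr0.
Qed.

Lemma sum_qchar (F : finFieldType) : odd #|F| -> 2%:R != 0 :> F -> \sum_(x : F) qchar F x = 0.
Proof.
move=> oF two_n0; have [u uN] := qchar_nonresidue F two_n0.
have u_n0 : u != 0 by apply: contra_eq_neq uN => ->; rewrite qchar0.
set s := \sum_x _; suff : s = - s by lia.
rewrite {1}/s (reindex_inj (mulfI u_n0)) /s -sumrN; apply: eq_bigr => x _.
by rewrite qcharM // uN mulN1r.
Qed.

Lemma odd_prime_Fp (p : nat) : prime p -> odd p ->
  [/\ #|'F_p| = p, odd #|'F_p|, 2%:R != 0 :> 'F_p & (2 < p)%N].
Proof.
move=> p_pr p_odd; have p_gt2 : (2 < p)%N by have := prime_gt1 p_pr; case: p p_odd {p_pr} => // -[|[|[]]].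
by rewrite !card_Fp //; split=> //; rewrite -(dvdn_pcharf (pchar_Fp p_pr)) gtnNdvd.
Qed.

Lemma natr_Fp_eq0 (p n : nat) : prime p -> ((n%:R : 'F_p) == 0) = (p %| n)%N.
Proof. by move=> p_pr; rewrite -(dvdn_pcharf (pchar_Fp p_pr)). Qed.

Lemma natr_Fp_mod (p n : nat) : prime p -> (n %% p)%:R = n%:R :> 'F_p.
Proof.
move=> p_pr; rewrite [in RHS](divn_eq n p) natrD natrM.
have /eqP -> : p%:R == 0 :> 'F_p by rewrite natr_Fp_eq0 // dvdnn.
by rewrite mulr0 add0r.
Qed.

(** * Quadratic reciprocity *)

Lemma euler_criterion_Fp (p : nat) (x : 'F_p) : prime p -> odd p ->
  (qchar 'F_p x)%:~R = x ^+ p./2.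
Proof.
move=> p_pr p_odd; have [cp op p2 _] := odd_prime_Fp p p_pr p_odd.
by rewrite euler_criterion // cp.
Qed.

(** The Gauss sum argument uses only this vanishing sum and its consequence [z ^ r = 1], so no
    primitive root of unity has to be constructed. *)
Lemma root_of_unity_sum0 (K : closedFieldType) (r : nat) :
  (1 < r)%N -> exists z : K, \sum_(i < r) z ^+ i = 0.
Proof.
case: r => [|[|r]] // _; have [z zE] := @solve_monicpoly K r.+1 (fun=> -1) isT.
exists z; rewrite big_ord_recr /= zE -big_split /=; apply: big1 => i _.
by rewrite mulN1r addrN.
Qed.

(** The values lie in an arbitrary field [K] because the sum will be formed in characteristic [p],
    where Frobenius acts on it. *)
Lemma gauss_sum_sqr (F : finFieldType) (K : fieldType) (psi : F -> K) :
  odd #|F| -> 2%:R != 0 :> F ->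
  (forall x y, psi (x + y) = psi x * psi y) -> psi 0 = 1 -> \sum_x psi x = 0 ->
  (\sum_x (qchar F x)%:~R * psi x) ^+ 2 = (qchar F (-1))%:~R * #|F|%:R.
Proof.
move=> oF two_n0 psiD psi0 psi_sum.
have psi_orth c : \sum_x psi (x * c) = (if c == 0 then #|F|%:R else 0).
  case: eqP => [-> | /eqP c_n0].
    by under eq_bigr do rewrite mulr0 psi0; rewrite sumr_const.
  by rewrite -[RHS]psi_sum [RHS](reindex_inj (mulIf c_n0)).
have chi_sum : \sum_x (qchar F x)%:~R = 0 :> K by rewrite -rmorph_sum /= sum_qchar.
rewrite expr2 big_distrlr /=.
(* With [y = x z], the product [chi(x) chi(y)] becomes [chi(z)]. *)
transitivity (\sum_(x | x != 0) \sum_z (qchar F z)%:~R * psi (x * (1 + z))).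
  rewrite (bigD1 0) //= [X in X + _]big1 ?add0r => [|y _]; last by rewrite qchar0 !mul0r.
  apply: eq_bigr => x x_n0; rewrite (reindex_inj (mulfI x_n0)); apply: eq_bigr => z _.
  rewrite mulrACA -psiD -intrM -qcharM // mulrA qcharM // qchar_sqr // mul1r.
  by rewrite mulrDr mulr1.
rewrite exchange_big /=.
(* Restoring the term [x = 0] costs 1 for each [z]; these corrections cancel because [chi] has sum
   zero, and orthogonality leaves only [z = -1]. *)
transitivity (\sum_z (qchar F z)%:~R * ((\sum_x psi (x * (1 + z))) - 1)).
  apply: eq_bigr => z _; rewrite -mulr_sumr; congr (_ * _).
  by rewrite [in RHS](bigD1 0) //= mul0r psi0 addrC addrK.
under eq_bigr do rewrite mulrBr mulr1 psi_orth.
rewrite sumrB chi_sum subr0 (bigD1 (-1)) //= addrN eqxx [X in _ + X]big1 ?addr0 // => z zN.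
by rewrite addrC addr_eq0 (negPf zN) mulr0.
Qed.

Lemma Fp_exp_additive (K : fieldType) (r : nat) (z : K) : prime r -> z ^+ r = 1 ->
  forall x y : 'F_r, z ^+ (x + y)%R = z ^+ x * z ^+ y.
Proof.
move=> r_pr zr x y; rewrite -exprD -(expr_mod (x + y)%N zr) /=.
by congr (_ ^+ (_ %% _)); apply: Fp_cast.
Qed.

Lemma qchar_opp1 (F : finFieldType) : odd #|F| -> 2%:R != 0 :> F ->
  qchar F (-1) = (-1) ^+ #|F|./2.
Proof.
move=> oF two_n0; apply: (intr_pm1_inj F) => //; first exact: qchar_mem.
  by rewrite -signr_odd; case: odd.
by rewrite euler_criterion // rmorphXn rmorphN1.
Qed.

(* The Gauss sum [g] of [F_r], formed in an algebraic closure of [F_p], satisfies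
   [g ^ 2 = (-1/r) r] and, by Frobenius, [g ^ p = (p/r) g]. *)
Lemma quadratic_reciprocity (p r : nat) : prime p -> prime r -> odd p -> odd r -> p != r ->
  qchar 'F_p r%:R = (-1) ^+ (r./2 * p./2)%N * qchar 'F_r p%:R.
Proof.
move=> p_pr r_pr p_odd r_odd p_neq_r.
have [cp op p2 _] := odd_prime_Fp p p_pr p_odd.
have [cr or r2 _] := odd_prime_Fp r r_pr r_odd.
have [K [FtoK _]] := countable_algebraic_closure 'F_p.
have pK : p \in [pchar K] by rewrite (fmorph_pchar FtoK) pchar_Fp.
have K2 : 2%:R != 0 :> K by rewrite -(rmorph_nat FtoK) fmorph_eq0.
have rK : r%:R != 0 :> K by rewrite -(dvdn_pcharf pK) dvdn_prime2.
have [z z0] := root_of_unity_sum0 K r (prime_gt1 r_pr).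
have zr : z ^+ r = 1 by apply/eqP; rewrite -subr_eq0 subrX1 z0 mulr0.
pose psi (x : 'F_r) := z ^+ x.
pose g := \sum_x (qchar 'F_r x)%:~R * psi x.
have psiD x y : psi (x + y) = psi x * psi y by rewrite /psi Fp_exp_additive.
have g2 : g ^+ 2 = (qchar 'F_r (-1))%:~R * r%:R.
  rewrite -[r in r%:R]cr; apply: gauss_sum_sqr => //.
  by rewrite -[RHS]z0 -!(big_mkord predT (fun i => z ^+ i)) Fp_cast.
have psiX x n : psi x ^+ n = psi (n%:R * x).
  by elim: n => [|n IH]; rewrite ?mul0r ?expr0 // exprS IH -psiD mulrS mulrDl mul1r.
have p_n0 : p%:R != 0 :> 'F_r by rewrite natr_Fp_eq0 // dvdn_prime2 // eq_sym.
have qp1 : qchar 'F_r p%:R * qchar 'F_r p%:R = 1 by rewrite -qcharM // qchar_sqr.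
have gp : g ^+ p = (qchar 'F_r p%:R)%:~R * g.
  rewrite -(pFrobenius_autE pK) rmorph_sum /= /g [in RHS](reindex_inj (mulfI p_n0)) mulr_sumr.
  apply: eq_bigr => x _; rewrite rmorphM /= !pFrobenius_autE psiX qcharM // intrM !mulrA.
  congr (_ * _); rewrite -intrM qp1 mul1r -rmorphXn /=.
  congr _%:~R; have := qchar_mem 'F_r x; rewrite !inE => /or3P[] /eqP -> //.
    by rewrite expr0n; case: (p) p_odd.
    by rewrite expr1n.
  by rewrite -signr_odd p_odd.
have g_n0 : g != 0.
  suff : g ^+ 2 != 0 by rewrite expf_eq0.
  rewrite g2 mulf_eq0 negb_or rK andbT qchar_opp1 // rmorphXn /= rmorphN1.
  by rewrite expf_eq0 oppr_eq0 oner_eq0 andbF.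
have pE : p = (2 * p./2).+1 by rewrite mul2n -[LHS]odd_double_half p_odd.
(* Writing [g ^ p] as [(g ^ 2) ^ p./2] times [g] and cancelling [g] compares the Frobenius value
   with Euler's criterion for [r] modulo [p]. *)
have key : (qchar 'F_r p%:R)%:~R = ((-1) ^+ (r./2 * p./2) * qchar 'F_p r%:R)%:~R :> K.
  have := gp; rewrite {1}pE exprSr exprM g2 => /(mulIf g_n0) <-.
  rewrite exprMn -rmorphXn /= qchar_opp1 // cr -exprM intrM; congr (_ * _).
  by rewrite -(rmorph_nat FtoK) -rmorphXn /= -euler_criterion_Fp // rmorph_int.
have : qchar 'F_r p%:R = (-1) ^+ (r./2 * p./2) * qchar 'F_p r%:R.
  apply: (intr_qchar_inj 'F_r K) => //; rewrite pm1M ?qchar_mem //.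
  by rewrite -signr_odd; case: odd.
by move=> ->; rewrite mulrA -exprMn mulrNN mulr1 expr1n mul1r.
Qed.

(** For odd [n], [chi8] is the symbol (2/n) and [chi4] is (-1/n); even arguments get the default
    value -1. *)
Definition chi8 (n : nat) : int := if ((n %% 8)%N == 1%N) || ((n %% 8)%N == 7) then 1 else -1.
Definition chi4 (n : nat) : int := if (n %% 4)%N == 1%N then 1 else -1.

Lemma chi4E (n : nat) : odd n -> chi4 n = (-1) ^+ n./2.
Proof.
move=> n_odd; rewrite /chi4 -signr_odd; have -> : ((n %% 4)%N == 1%N) = ~~ odd n./2 by lia.
by case: odd.
Qed.

(* With [z ^ 4 = -1], [t = z + 1/z] is a square root of [2] and [t ^ p = z ^ p + 1/z ^ p]. *)
Lemma qchar_two (p : nat) : prime p -> odd p -> qchar 'F_p 2%:R = chi8 p.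
Proof.
move=> p_pr p_odd.
have [cp op p2 _] := odd_prime_Fp p p_pr p_odd.
have [K [FtoK _]] := countable_algebraic_closure 'F_p.
have pK : p \in [pchar K] by rewrite (fmorph_pchar FtoK) pchar_Fp.
have K2 : 2%:R != 0 :> K by rewrite -(rmorph_nat FtoK) fmorph_eq0.
have [z] := @solve_monicpoly K 4 (fun i => if i == 0%N then -1 else 0) isT.
rewrite !big_ord_recl big_ord0 /= !mul0r !addr0 expr0 mulr1 => z4.
have z_n0 : z != 0 by apply: contra_eq_neq z4 => ->; rewrite expr0n eq_sym oppr_eq0 oner_eq0.
pose t := z + z^-1.
have t2 : t ^+ 2 = 2%:R.
  have : z ^+ 2 * (t ^+ 2 - 2%:R) = z ^+ 4 + 1 by rewrite /t; field.
  by rewrite z4 addNr => /eqP; rewrite mulf_eq0 expf_eq0 (negPf z_n0) subr_eq0 => /eqP.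
have t_n0 : t != 0 by have := K2; rewrite -t2 expf_eq0.
have tp : t ^+ p = (chi8 p)%:~R * t.
  rewrite -(pFrobenius_autE pK) rmorphD fmorphV /= !pFrobenius_autE.
  have z8 : z ^+ 8 = 1 by rewrite (exprM z 4 2) z4 sqrrN expr1n.
  rewrite -(expr_mod p z8) /chi8.
  have : (p %% 8)%N \in [:: 1; 3; 5; 7]%N by rewrite !inE; lia.
  rewrite !inE => /or4P[] /eqP -> /=; rewrite /t ?rmorph1 ?rmorphN1.
  - by rewrite mul1r expr1.
  - have : z ^+ 3 * (z ^+ 3 + (z ^+ 3)^-1 - -1 * (z + z^-1)) = (z ^+ 2 + 1) * (z ^+ 4 + 1).
      by field.
    by rewrite z4 addNr mulr0 => /eqP; rewrite mulf_eq0 expf_eq0 (negPf z_n0) subr_eq0 => /eqP.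
  - have : z ^+ 5 * (z ^+ 5 + (z ^+ 5)^-1 - -1 * (z + z^-1)) = (z ^+ 6 + 1) * (z ^+ 4 + 1).
      by field.
    by rewrite z4 addNr mulr0 => /eqP; rewrite mulf_eq0 expf_eq0 (negPf z_n0) subr_eq0 => /eqP.
  - have -> : z ^+ 7 = z^-1 by apply: (mulfI z_n0); rewrite -exprS z8 divff.
    by rewrite invrK mul1r addrC.
have pE : p = (2 * p./2).+1 by rewrite mul2n -[LHS]odd_double_half p_odd.
apply: (intr_qchar_inj _ K) => //; first by rewrite /chi8; case: ifP.
have := tp; rewrite {1}pE exprSr exprM t2 => /(mulIf t_n0) <-.
by rewrite -(rmorph_nat FtoK) -rmorphXn /= -euler_criterion_Fp // rmorph_int.
Qed.

(** * The Jacobi symbol as a character in either argument *)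

Definition jac (a b : nat) : int := \prod_(p <- primes b) qchar 'F_p a%:R ^+ logn p b.

Lemma IZR_legendre (a p : nat) : prime p -> IZR (legendre a p) = (qchar 'F_p a%:R)%:~R :> R.
Proof.
move=> p_pr; rewrite /legendre /qchar natr_Fp_eq0 //; case: ifP => // _.
have -> : [exists x : 'I_p, (x * x) %% p == a %% p]%N = [exists y : 'F_p, y * y == a%:R].
  have e (x : nat) : ((x * x) %% p == a %% p)%N = ((x%:R : 'F_p) * x%:R == a%:R).
    by rewrite -natrM -val_eqE /= !val_Fp_nat.
  apply/existsP/existsP => -[x xP].
    by exists x%:R; rewrite -e.
  have lt : (x < p)%N by rewrite -[X in (_ < X)%N](Fp_cast p_pr) ltn_ord.
  by exists (Ordinal lt); rewrite /= e natr_Zp.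
by case: ifP; rewrite ?rmorph1 ?rmorphN1.
Qed.

Lemma IZR_jacobi (a b : nat) : IZR (jacobi a b) = (jac a b)%:~R :> R.
Proof.
rewrite /jacobi /jac.
have : all prime (primes b) by apply/allP => p; rewrite mem_primes => /andP[].
elim: (primes b) => [|p s IH] /=; first by rewrite big_nil.
case/andP=> p_pr /IH {}IH; rewrite big_cons intrM -IH mult_IZR; congr (_ * _).
by rewrite -pow_IZR IZR_legendre // RpowE rmorphXn.
Qed.

Lemma chi4M (m n : nat) : odd m -> odd n -> chi4 (m * n) = chi4 m * chi4 n.
Proof.
move=> m_odd n_odd; rewrite /chi4 -modnMm.
have : (m %% 4)%N \in [:: 1; 3]%N by rewrite !inE; lia.
have : (n %% 4)%N \in [:: 1; 3]%N by rewrite !inE; lia.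
by rewrite !inE => /orP[] /eqP -> /orP[] /eqP ->.
Qed.

Lemma chi8M (m n : nat) : odd m -> odd n -> chi8 (m * n) = chi8 m * chi8 n.
Proof.
move=> m_odd n_odd; rewrite /chi8 -modnMm.
have : (m %% 8)%N \in [:: 1; 3; 5; 7]%N by rewrite !inE; lia.
have : (n %% 8)%N \in [:: 1; 3; 5; 7]%N by rewrite !inE; lia.
by rewrite !inE => /or4P[] /eqP -> /or4P[] /eqP ->.
Qed.

Lemma chi4_sqr (n : nat) : chi4 n ^+ 2 = 1.
Proof. by rewrite /chi4; case: ifP. Qed.

Lemma chi8_sqr (n : nat) : chi8 n ^+ 2 = 1.
Proof. by rewrite /chi8; case: ifP. Qed.

Lemma natr_Fp_qcharM (p m n : nat) : prime p -> odd p ->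
  qchar 'F_p (m * n)%:R = qchar 'F_p m%:R * qchar 'F_p n%:R.
Proof. by move=> p_pr p_odd; have [_ op p2 _] := odd_prime_Fp p p_pr p_odd; rewrite natrM qcharM. Qed.

Lemma odd_primes (b p : nat) : odd b -> p \in primes b -> prime p /\ odd p.
Proof. by move=> b_odd; rewrite mem_primes => /and3P[-> _ /dvdn_odd]; split=> //; auto. Qed.

Lemma jacMl (m n b : nat) : odd b -> jac (m * n) b = jac m b * jac n b.
Proof.
move=> b_odd; rewrite /jac -big_split /= big_seq [RHS]big_seq.
by apply: eq_bigr => p /(odd_primes b p b_odd)[p_pr p_odd]; rewrite natr_Fp_qcharM // exprMn.
Qed.

Lemma jac_mod (n b : nat) : jac (n %% b) b = jac n b.
Proof.
rewrite /jac big_seq [RHS]big_seq; apply: eq_bigr => p; rewrite mem_primes => /and3P[p_pr _ pb].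
by rewrite -(natr_Fp_mod p) // modn_dvdm // natr_Fp_mod.
Qed.

Lemma jac_sqr (n b : nat) : coprime n b -> jac n b ^+ 2 = 1.
Proof.
move=> cnb; rewrite /jac -prodrXl big_seq big1 // => p; rewrite mem_primes => /and3P[p_pr b_gt0 pb].
have n0 : n%:R != 0 :> 'F_p.
  rewrite natr_Fp_eq0 //; apply/negP => pn.
  have : (p %| gcdn n b)%N by rewrite dvdn_gcd pn pb.
  by rewrite (eqP cnb) Euclid_dvd1.
by rewrite -exprM mulnC exprM; case: (qcharP _ _ n0) => ->; rewrite ?sqrrN !expr1n.
Qed.

(** For prime [r] and odd [n] this is (r/n) rewritten by reciprocity, in a form that depends only on
    [n] modulo 8 or modulo [4 r]. *)
Definition kronecker_factor (r n : nat) : int :=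
  if r == 2%N then chi8 n else chi4 n ^+ r./2 * qchar 'F_r n%:R.

Lemma kronecker_factor_prime (r l : nat) : prime r -> prime l -> odd l ->
  qchar 'F_l r%:R = kronecker_factor r l.
Proof.
move=> r_pr l_pr l_odd; rewrite /kronecker_factor; case: eqP => [-> | /eqP r2]; first exact: qchar_two.
have r_odd : odd r by case: (even_prime r_pr) r2 => // ->.
(* Reciprocity needs distinct primes; when [l = r] both sides vanish. *)
have [-> | l_r] := eqVneq l r.
  have -> : r%:R = 0 :> 'F_r by apply/eqP; rewrite natr_Fp_eq0.
  by rewrite qchar0 mulr0.
by rewrite quadratic_reciprocity // chi4E // -exprM [(l./2 * _)%N]mulnC.
Qed.

Lemma kronecker_factorM (r m n : nat) : prime r -> odd m -> odd n ->
  kronecker_factor r (m * n) = kronecker_factor r m * kronecker_factor r n.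
Proof.
move=> r_pr m_odd n_odd; rewrite /kronecker_factor; case: eqP => [_ | /eqP r2]; first exact: chi8M.
have r_odd : odd r by case: (even_prime r_pr) r2 => // ->.
by rewrite chi4M // exprMn natr_Fp_qcharM // mulrACA.
Qed.

Lemma kronecker_factor1 (r : nat) : kronecker_factor r 1 = 1.
Proof. by rewrite /kronecker_factor; case: ifP => // _; rewrite qchar1 mulr1 expr1n. Qed.

Lemma completely_multiplicative_prod (f : nat -> int) (n : nat) : f 1%N = 1 ->
  (forall a b, odd a -> odd b -> f (a * b)%N = f a * f b) -> odd n ->
  f n = \prod_(p <- primes n) f p ^+ logn p n.
Proof.
move=> f1 fM n_odd.
have fX p e : odd p -> odd (p ^ e) /\ f (p ^ e)%N = f p ^+ e.
  move=> p_odd; split; first by rewrite oddX p_odd orbT.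
  by elim: e => // e IH; rewrite expnS fM ?IH -?exprS // oddX p_odd orbT.
have : all odd (primes n) by apply/allP => p /(odd_primes n p n_odd)[].
suff H s : all odd s -> odd (\prod_(p <- s) p ^ logn p n)%N /\
    f (\prod_(p <- s) p ^ logn p n)%N = \prod_(p <- s) f p ^+ logn p n.
  move/H=> [_ <-]; congr f.
  by rewrite {1}(prod_prime_decomp (odd_gt0 n_odd)) prime_decompE big_map.
elim: s => [|p s IH] /=; first by rewrite !big_nil.
case/andP=> p_odd /IH[os fs]; have [o1 f1'] := fX p (logn p n) p_odd.
by rewrite !big_cons oddM o1 os fM // fs f1'.
Qed.

(** The right side is completely multiplicative in odd [n], so it is determined by its values at
    primes [l]; there the claim is multiplicativity of (./l) over the factorisation of [q]. *)
Lemma jac_kronecker (q n : nat) : (0 < q)%N -> odd n ->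
  jac q n = \prod_(r <- primes q) kronecker_factor r n ^+ logn r q.
Proof.
move=> q_gt0 n_odd; pose f m := \prod_(r <- primes q) kronecker_factor r m ^+ logn r q.
have f1 : f 1%N = 1 by rewrite /f big1 // => r _; rewrite kronecker_factor1 expr1n.
have fM a b : odd a -> odd b -> f (a * b)%N = f a * f b.
  move=> a_odd b_odd; rewrite /f -big_split /= big_seq [RHS]big_seq; apply: eq_bigr => r.
  by rewrite mem_primes => /andP[r_pr _]; rewrite kronecker_factorM // exprMn.
rewrite -/(f n) (completely_multiplicative_prod f n f1 fM n_odd) /jac big_seq [RHS]big_seq.
apply: eq_bigr => l /(odd_primes n l n_odd)[l_pr l_odd]; congr (_ ^+ _).
rewrite {1}(prod_prime_decomp q_gt0) prime_decompE big_map /= /f.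
have := fun r => kronecker_factor_prime r l.
have : all prime (primes q) by apply/allP => r; rewrite mem_primes => /andP[].
elim: (primes q) => [|r s IH] /=; first by rewrite !big_nil qchar1.
case/andP=> r_pr /IH {}IH H; rewrite !big_cons natr_Fp_qcharM // IH // -H //; congr (_ * _).
by elim: (logn r q) => [|e IHe]; rewrite ?expr0 ?qchar1 // exprS expnS natr_Fp_qcharM // IHe.
Qed.

Lemma jacMr (q m n : nat) : (0 < q)%N -> odd m -> odd n -> jac q (m * n) = jac q m * jac q n.
Proof.
move=> q_gt0 m_odd n_odd; rewrite !jac_kronecker ?oddM ?m_odd // -big_split /= big_seq [RHS]big_seq.
by apply: eq_bigr => r; rewrite mem_primes => /andP[r_pr _]; rewrite kronecker_factorM // exprMn.
Qed.

Lemma chi4_mod (m q : nat) : (4 %| q)%N -> chi4 (m %% q) = chi4 m.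
Proof. by move=> q4; rewrite /chi4 modn_dvdm. Qed.

(** [chi8] has period 8 while only 4 is assumed to divide [q]; this covers the case where [chi8]
    really occurs, since an odd exponent at least 2 is at least 3. *)
Lemma logn2_odd (q : nat) : (0 < q)%N -> (4 %| q)%N -> odd (logn 2 q) -> (8 %| q)%N.
Proof.
move=> q_gt0; rewrite -[4%N]/(2 ^ 2)%N -[8%N]/(2 ^ 3)%N !pfactor_dvdn // => l2 l_odd.
by case: (logn 2 q) l2 l_odd => [|[|[|]]].
Qed.

(** For [r = 2], either 8 divides [q] or the even exponent turns [chi8] into 1. For odd [r], both 4
    and [r] divide [q], which fixes [chi4] and the residue modulo [r]. *)
Lemma kronecker_factor_congr (q r m n : nat) : (0 < q)%N -> (4 %| q)%N -> prime r -> (r %| q)%N ->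
  (m = n %[mod q])%N -> kronecker_factor r m ^+ logn r q = kronecker_factor r n ^+ logn r q.
Proof.
move=> q_gt0 q4 r_pr rq mn; rewrite /kronecker_factor; case: eqP => [rE | /eqP r2].
  subst r; case l_odd : (odd (logn 2 q)).
    by rewrite /chi8 -(modn_dvdm m (logn2_odd _ q_gt0 q4 l_odd)) mn modn_dvdm ?logn2_odd.
  by rewrite -[logn 2 q]odd_double_half l_odd -mul2n !exprM !chi8_sqr.
have -> : chi4 m = chi4 n by rewrite -(chi4_mod m q) // mn chi4_mod.
by rewrite -(natr_Fp_mod r) // -(modn_dvdm m rq) mn modn_dvdm // natr_Fp_mod.
Qed.

Lemma jac_congr (q m n : nat) : (0 < q)%N -> (4 %| q)%N -> odd m -> odd n ->
  (m = n %[mod q])%N -> jac q m = jac q n.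
Proof.
move=> q_gt0 q4 m_odd n_odd mn; rewrite !jac_kronecker // big_seq [RHS]big_seq.
by apply: eq_bigr => r; rewrite mem_primes => /and3P[r_pr _ rq]; apply: kronecker_factor_congr.
Qed.

(** * Units at which the Jacobi symbol is -1 *)

Lemma nonsquare_odd_logn (q : nat) : (0 < q)%N -> ~ is_square q ->
  exists2 r, r \in primes q & odd (logn r q).
Proof.
move=> q_gt0 nsq; apply/hasP/negPn/negP => /hasPn even; apply: nsq.
exists (\prod_(r <- primes q) r ^ (logn r q)./2)%N.
rewrite {1}(prod_prime_decomp q_gt0) prime_decompE big_map /= -big_split /=.
rewrite big_seq [RHS]big_seq; apply: eq_bigr => r /even /negPf l_even.
by rewrite -expnD addnn -{1}[logn r q]odd_double_half l_even.
Qed.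

(** Serves to change the sign of a single local factor, the one at [r]. *)
Lemma chinese_unit (q r a : nat) : (0 < q)%N -> r \in primes q -> coprime a r ->
  exists u, [/\ (u = a %[mod q`_r])%N, (u = 1 %[mod q`_r^'])%N & coprime u q].
Proof.
move=> q_gt0 rq car.
have cop : coprime q`_r q`_r^' by apply: coprime_partC.
have coprime_q u : coprime u q`_r -> coprime u q`_r^' -> coprime u q.
  by move=> u1 u2; rewrite -(partnC r q_gt0) coprimeMr u1.
exists (chinese q`_r q`_r^' a 1); split; [exact: chinese_modl | exact: chinese_modr |].
apply: coprime_q; first by rewrite -coprime_modl chinese_modl // coprime_modl p_part coprimeXr.
by rewrite -coprime_modl chinese_modr // coprime_modl coprime1n.
Qed.

Lemma dvdn_partC (q r s e : nat) : (0 < q)%N -> prime r -> prime s -> s != r ->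
  (s ^ e %| q)%N -> (s ^ e %| q`_r^')%N.
Proof.
move=> q_gt0 r_pr s_pr s_r; move=> sq.
rewrite -(@Gauss_dvdr _ q`_r) ?partnC // p_part coprimeXl // coprimeXr // prime_coprime //.
by rewrite dvdn_prime2.
Qed.

(** Take [u] a nonresidue at a prime [r] of odd exponent and 1 modulo the rest of [q]: exactly one
    factor of the product is -1. *)
Lemma jac_nonprincipal_odd (q : nat) : odd q -> ~ is_square q ->
  exists2 u, coprime u q & jac u q = -1.
Proof.
move=> q_odd nsq; have q_gt0 := odd_gt0 q_odd.
have [r rq l_odd] := nonsquare_odd_logn q q_gt0 nsq.
have [r_pr r_odd] := odd_primes q r q_odd rq.
have [_ or r2 _] := odd_prime_Fp r r_pr r_odd.
have [x xN] := qchar_nonresidue 'F_r r2.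
have xr : coprime x r.
  rewrite coprime_sym prime_coprime // -(natr_Fp_eq0 r) // natr_Zp.
  by apply: contra_eq_neq xN => ->; rewrite qchar0.
have [u [ua u1 uq]] := chinese_unit q r x q_gt0 rq xr; exists u => //.
have part_dv s : s \in primes q -> s != r -> (u = 1 %[mod s])%N.
  rewrite mem_primes => /and3P[s_pr _ sq] s_r.
  have := dvdn_partC q r s 1 q_gt0 r_pr s_pr s_r; rewrite expn1 => /(_ sq) sr.
  by rewrite -(modn_dvdm u sr) u1 modn_dvdm.
have ur : (u = x %[mod r])%N.
  have sr : (r %| q`_r)%N by rewrite p_part dvdn_exp ?logn_gt0.
  by rewrite -(modn_dvdm u sr) ua modn_dvdm.
rewrite /jac (bigD1_seq r) ?primes_uniq //= big_seq_cond big1 ?mulr1 => [|s /andP[sq s_r]].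
  by rewrite -(natr_Fp_mod r) // ur natr_Fp_mod // natr_Zp xN -signr_odd l_odd.
have [s_pr _] := odd_primes q s q_odd sq.
by rewrite -(natr_Fp_mod s) // part_dv // natr_Fp_mod // qchar1 expr1n.
Qed.

(** The extra condition [chi4 u = 1] makes the same [u] a witness that the product of [chi4] and
    [jac q] is nonprincipal too; it also removes the [chi4] part of each Kronecker factor. *)
Lemma jac_nonprincipal_even (q : nat) : (0 < q)%N -> (4 %| q)%N -> ~ is_square q ->
  exists u, [/\ coprime u q, chi4 u = 1 & jac q u = -1].
Proof.
move=> q_gt0 q4 nsq.
have [r rq l_odd] := nonsquare_odd_logn q q_gt0 nsq.
have r_pr : prime r by move: rq; rewrite mem_primes => /andP[].
have r_dv : (r %| q`_r)%N by rewrite p_part dvdn_exp ?logn_gt0.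
(* The residue 5 is 1 modulo 4 but has [chi8 5 = -1]; if 2 has odd exponent, 8 divides [q] and this
   residue modulo 8 can be prescribed. *)
have [x xr [x4 xN]] : exists2 x, coprime x r & (r = 2%N -> x = 5%N) /\
    (r != 2%N -> qchar 'F_r x%:R = -1).
  have [-> | r2] := eqVneq r 2%N; first by exists 5%N.
  have r_odd : odd r by case: (even_prime r_pr) r2 => // ->.
  have [_ or r2' _] := odd_prime_Fp r r_pr r_odd.
  have [x xN] := qchar_nonresidue 'F_r r2'; exists x; last by split=> [/eqP|]; rewrite ?(negPf r2) ?natr_Zp.
  rewrite coprime_sym prime_coprime // -(natr_Fp_eq0 r) // natr_Zp.
  by apply: contra_eq_neq xN => ->; rewrite qchar0.
have [u [ua u1 uq]] := chinese_unit q r x q_gt0 rq xr; exists u.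
have u_odd : odd u.
  have : coprime u 2 by apply: coprime_dvdr uq; apply: dvdn_trans q4.
  by rewrite coprime_sym prime_coprime // dvdn2 negbK.
have part_dv s e : s \in primes q -> s != r -> (s ^ e %| q)%N -> (u = 1 %[mod s ^ e])%N.
  rewrite mem_primes => /and3P[s_pr _ sq] s_r se.
  have sr := dvdn_partC q r s e q_gt0 r_pr s_pr s_r se.
  by rewrite -(modn_dvdm u sr) u1 modn_dvdm.
have two_q : 2%N \in primes q by rewrite mem_primes q_gt0 (dvdn_trans _ q4).
have u8 : r = 2%N -> (u = 5 %[mod 8])%N.
  move=> r2; have q8 : (8 %| q`_r)%N.
    by rewrite r2 p_part (@dvdn_exp2l 2 3) // -pfactor_dvdn // (logn2_odd q) // -r2.
  by rewrite -(modn_dvdm u q8) ua (x4 r2) modn_dvdm.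
have u4 : (u = 1 %[mod 4])%N.
  have [r2 | r2] := eqVneq r 2%N; last by apply: (part_dv 2 2)%N => //; rewrite eq_sym.
  by rewrite -(modn_dvdm u (_ : 4 %| 8)%N) // u8.
have chiu : chi4 u = 1 by rewrite /chi4 u4.
split=> //.
rewrite jac_kronecker // (bigD1_seq r) ?primes_uniq //= big_seq_cond big1 ?mulr1 => [|s /andP[sq s_r]].
  rewrite -[logn r q]odd_double_half l_odd exprS -mul2n exprM.
  have -> : kronecker_factor r u = -1.
    rewrite /kronecker_factor; case: eqP => [r2 | /eqP r2]; first by rewrite /chi8 u8.
    rewrite chiu expr1n mul1r -(natr_Fp_mod r) // -(modn_dvdm u r_dv) ua modn_dvdm // natr_Fp_mod //.
    exact: xN.
  by rewrite sqrrN !expr1n mulr1.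
have [s_pr s_dv] : prime s /\ (s %| q)%N by move: sq; rewrite mem_primes => /and3P[].
rewrite /kronecker_factor; case: eqP => [s2 | /eqP s2].
  (* Here [r] is odd and the factor at 2 must be 1: either [u] is 1 modulo 8, or the exponent is
     even. *)
  subst s; case l2 : (odd (logn 2 q)).
    by rewrite /chi8 (part_dv 2 3)%N ?expr1n // (logn2_odd q).
  by rewrite -[logn 2 q]odd_double_half l2 -mul2n exprM chi8_sqr expr1n.
rewrite chiu expr1n mul1r -(natr_Fp_mod s) // -[X in (u %% X)%N]expn1 part_dv // expn1 natr_Fp_mod //.
by rewrite qchar1 expr1n.
Qed.

(** * Fejer interpolation *)

Definition cexp1 (x : R) : R[i] := complex.Complex (cos (2%:R * PI * x)%R) (sin (2%:R * PI * x)%R).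

Arguments cexp1 x%_R.

Lemma cexp1D (x y : R) : cexp1 (x + y) = cexp1 x * cexp1 y.
Proof.
rewrite /cexp1 mulrDr -!RplusE cos_plus sin_plus.
by apply/eqP; rewrite eq_complex /= RminusE !RplusE !RmultE eqxx /= addrC.
Qed.

Lemma cexp1_0 : cexp1 0 = 1.
Proof. by rewrite /cexp1 mulr0 cos_0 sin_0. Qed.

Lemma cexp1N (x : R) : cexp1 (- x) = (cexp1 x)^*.
Proof. by rewrite /cexp1 mulrN cos_neg sin_neg. Qed.

Lemma cexp1B (x y : R) : cexp1 (x - y) = cexp1 x * (cexp1 y)^*.
Proof. by rewrite cexp1D cexp1N. Qed.

Lemma norm_cexp1 (x : R) : `|cexp1 x| = 1.
Proof.
apply/eqP; rewrite -(@eqrXn2 _ 2) ?normr_ge0 //.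
by rewrite normCK -cexp1B subrr cexp1_0 expr1n.
Qed.

Lemma cexp1Mn (x : R) (n : nat) : cexp1 (n%:R * x) = cexp1 x ^+ n.
Proof.
elim: n => [|n IH]; first by rewrite mul0r cexp1_0.
by rewrite exprS -IH -cexp1D mulrS mulrDl mul1r.
Qed.

Lemma cexp1_1 : cexp1 1 = 1.
Proof. by rewrite /cexp1 mulr1 cos_2PI sin_2PI. Qed.

Lemma cexp1_nat (n : nat) : cexp1 n%:R = 1.
Proof. by rewrite -[n%:R]mulr1 cexp1Mn cexp1_1 expr1n. Qed.

(** The real part is [1 - 2 sin (pi x) ^ 2], and this sine is positive. *)
Lemma cexp1_neq1 (x : R) : 0 < x < 1 -> cexp1 x != 1.
Proof.
case/andP=> x_gt0 x_lt1; apply/negP; rewrite eq_complex /= => /andP[/eqP cE _].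
have PI_gt0 : 0 < PI by apply/RltP; apply: PI_RGT_0.
have s_gt0 : 0 < sin (PI * x)%R.
  apply/RltP; apply: sin_gt_0; apply/RltP; first by rewrite mulr_gt0.
  by rewrite -[X in _ < X]mulr1 ltr_pM2l.
have := cos_2a_sin (PI * x)%R; have -> : Rmult 2 (PI * x)%R = 2%:R * PI * x by rewrite -mulrA.
rewrite cE RminusE !RmultE; change (IZR 2) with (2%:R : R); change (IZR 1) with (1 : R).
by move/eqP; rewrite eq_sym subr_eq addrC -subr_eq subrr eq_sym !mulf_eq0 pnatr_eq0 /= orbb gt_eqF.
Qed.

Lemma cexp1_frac_neq1 (a b M : nat) : (a < M)%N -> (b < M)%N -> a != b ->
  cexp1 ((a%:R - b%:R) / M%:R) != 1.
Proof.
wlog ab : a b / (b < a)%N => [hw|] aM bM a_b.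
  case: (ltngtP b a) => ba; [exact: hw | | by rewrite ba eqxx in a_b].
  have := hw b a ba bM aM; rewrite eq_sym => /(_ a_b); apply: contraNneq => e.
  by rewrite -opprB mulNr cexp1N e rmorph1.
have M_gt0 : 0 < M%:R :> R by rewrite ltr0n (leq_trans _ aM).
apply: cexp1_neq1; rewrite ltr_pdivlMr // ltr_pdivrMr // mul0r mul1r subr_gt0 ltr_nat ab /=.
by rewrite -natrB ?(ltnW ab) // ltr_nat (leq_ltn_trans (leq_subr _ _)).
Qed.

Lemma cexp1_sum_roots (a b M : nat) : (a < M)%N -> (b < M)%N ->
  \sum_(j < M) cexp1 ((a%:R - b%:R) * (j%:R / M%:R)) = (if a == b then M%:R else 0).
Proof.
move=> aM bM; case: eqP => [-> | /eqP a_b].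
  under eq_bigr do rewrite subrr mul0r cexp1_0.
  by rewrite sumr_const card_ord.
set w := cexp1 ((a%:R - b%:R) / M%:R).
have M_n0 : M%:R != 0 :> R by rewrite pnatr_eq0; case: (M) aM.
transitivity (\sum_(j < M) w ^+ j).
  by apply: eq_bigr => j _; rewrite -cexp1Mn; congr cexp1; field.
have wM : w ^+ M = 1.
  rewrite -cexp1Mn; have -> : M%:R * ((a%:R - b%:R) / M%:R) = a%:R - b%:R :> R by field.
  by rewrite cexp1B !cexp1_nat rmorph1 mulr1.
have := subrX1 w M; rewrite wM subrr => /esym/eqP; rewrite mulf_eq0 subr_eq0.
by rewrite (negPf (cexp1_frac_neq1 _ _ _ aM bM a_b)) => /eqP.
Qed.

Definition Zp_char (q : nat) (x : 'Z_q) : R[i] := cexp1 ((x : nat)%:R / q%:R).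

Lemma cexp1_nat_frac (q m : nat) : (0 < q)%N -> cexp1 ((m %% q)%N%:R / q%:R) = cexp1 (m%:R / q%:R).
Proof.
move=> q_gt0; have q_n0 : q%:R != 0 :> R by rewrite pnatr_eq0 -lt0n.
have -> : m%:R / q%:R = (m %/ q)%N%:R + (m %% q)%N%:R / q%:R :> R.
  by rewrite {1}(divn_eq m q) natrD natrM; field.
by rewrite cexp1D cexp1_nat mul1r.
Qed.

Lemma Zp_char_nat (q m : nat) : (1 < q)%N -> Zp_char q m%:R = cexp1 (m%:R / q%:R).
Proof. by move=> q_gt1; rewrite /Zp_char val_Zp_nat // cexp1_nat_frac // ltnW. Qed.

Lemma Zp_char_additive (q : nat) : (1 < q)%N -> additive_character R[i] 'Z_q (Zp_char q).
Proof.
move=> q_gt1.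
have charD x y : Zp_char q (x + y) = Zp_char q x * Zp_char q y.
  rewrite -[x in LHS]natr_Zp -[y in LHS]natr_Zp -natrD Zp_char_nat // natrD mulrDl cexp1D //.
split=> // [x | x x_n0]; first exact: norm_cexp1.
set s := \sum_a _; have : s = Zp_char q x * s.
  rewrite /s mulr_sumr (reindex_inj (addrI 1)) /=; apply: eq_bigr => a _.
  by rewrite mulrDl mul1r charD.
move/eqP; rewrite -subr_eq0 -{1}[s]mul1r -mulrBl mulf_eq0 subr_eq0 eq_sym.
have -> : (Zp_char q x == 1) = false; last by move/eqP.
have xq : (x < q)%N by rewrite -[X in (_ < X)%N](Zp_cast q_gt1) ltn_ord.
have := cexp1_frac_neq1 x 0 q xq (ltnW q_gt1); rewrite subr0 => H; apply/negbTE/H.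
by move: x_n0; rewrite -val_eqE.
Qed.

(** Dividing by [M ^ 2] instead of the usual [M] makes the translates by the [M] grid points sum to
    1, rather than the integral equal 1. *)
Definition fejer (M : nat) (x : R) : R[i] := `|\sum_(a < M) cexp1 (a%:R * x)| ^+ 2 / M%:R ^+ 2.

Arguments fejer M%_N x%_R.

Lemma fejer_ge0 (M : nat) (x : R) : 0 <= fejer M x.
Proof. by rewrite divr_ge0 ?exprn_ge0 ?ler0n. Qed.

Lemma fejerE (M : nat) (x y : R) : fejer M (x - y) =
  (M%:R ^+ 2)^-1 * \sum_(a < M) \sum_(b < M)
     (cexp1 ((a%:R - b%:R) * y))^* * cexp1 ((a%:R - b%:R) * x).
Proof.
rewrite /fejer mulrC normCK rmorph_sum big_distrlr /=; congr (_ * _).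
apply: eq_bigr => a _; apply: eq_bigr => b _.
by rewrite -cexp1B -cexp1N -cexp1D; congr cexp1; ring.
Qed.

(** Summing over the grid kills every frequency [a - b] other than 0, since these are smaller than
    [M] in absolute value. *)
Lemma fejer_sum1 (M : nat) (x : R) : (0 < M)%N -> \sum_(j < M) fejer M (x - j%:R / M%:R) = 1.
Proof.
move=> M_gt0; have M_n0 : M%:R != 0 :> R[i] by rewrite pnatr_eq0 -lt0n.
under eq_bigr do rewrite fejerE.
rewrite -mulr_sumr exchange_big /=.
transitivity ((M%:R ^+ 2)^-1 * \sum_(a < M) (M%:R : R[i])).
  congr (_ * _); apply: eq_bigr => a _; rewrite exchange_big /=.
  rewrite (bigD1 a) //= [X in _ + X]big1 ?addr0 => [|b b_a].
    rewrite -mulr_suml -rmorph_sum cexp1_sum_roots // eqxx subrr mul0r cexp1_0 mulr1.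
    exact: rmorph_nat.
  rewrite -mulr_suml -rmorph_sum cexp1_sum_roots // eq_sym -val_eqE in b_a *.
  by rewrite /= (negPf b_a) rmorph0 mul0r.
by rewrite sumr_const card_ord -[M%:R *+ M]mulr_natr -expr2 mulVf // expf_neq0.
Qed.

(** With [y = x - j / M], the product of [e(y) - 1] and the geometric sum is [e(M y) - 1], of
    modulus at most 2. *)
Lemma fejer_concentration (M : nat) (x : R) (j : nat) : (0 < M)%N ->
  `|cexp1 x - cexp1 (j%:R / M%:R)| ^+ 2 * fejer M (x - j%:R / M%:R) <= 4%:R / M%:R ^+ 2.
Proof.
move=> M_gt0; rewrite /fejer mulrA ler_wpM2r ?invr_ge0 ?exprn_ge0 ?ler0n //.
set y := x - _; have -> : `|cexp1 x - cexp1 (j%:R / M%:R)| = `|cexp1 y - 1|.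
  have -> : cexp1 x = cexp1 y * cexp1 (j%:R / M%:R) by rewrite -cexp1D subrK.
  by rewrite -{2}[cexp1 (_ / _)]mul1r -mulrBl normrM norm_cexp1 mulr1.
rewrite -exprMn -normrM.
have -> : (cexp1 y - 1) * \sum_(a < M) cexp1 (a%:R * y) = cexp1 y ^+ M - 1.
  by rewrite subrX1; congr (_ * _); apply: eq_bigr => a _; rewrite cexp1Mn.
have -> : 4%:R = 2%:R ^+ 2 :> R[i] by ring.
rewrite lerXn2r ?nnegrE ?ler0n ?mulr_ge0 //.
by apply: le_trans (ler_normB _ _) _; rewrite normr1 normrX norm_cexp1 expr1n -mulr2n.
Qed.

Definition grid (M j : nat) : R := (j%:R / M%:R)%R.

Definition fejer_interpolant (F : R -> R -> R[i]) (M : nat) (x y : R) : R[i] :=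
  \sum_(j < M) \sum_(k < M) F (grid M j) (grid M k) *
    (fejer M (x - grid M j) * fejer M (y - grid M k)).

Definition grid_mean (F : R -> R -> R[i]) (M : nat) : R[i] :=
  (M%:R ^+ 2)^-1 * \sum_(j < M) \sum_(k < M) F (grid M j) (grid M k).
Arguments fejer_interpolant F M x%_R y%_R.

(** The kernel weights are nonnegative with total 1, so the hypothesis can be averaged against them;
    each coordinate contributes [M] terms of at most [4 / M ^ 2], hence [8 / M] together. *)
Lemma fejer_interpolant_approx (F : R -> R -> R[i]) (c A : R[i]) (M : nat) (x y : R) :
  (0 < M)%N -> 0 <= A ->
  (forall x y x' y', `|F x y - F x' y'| <=
     c + A * (`|cexp1 x - cexp1 x'| ^+ 2 + `|cexp1 y - cexp1 y'| ^+ 2)) ->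
  `|F x y - fejer_interpolant F M x y| <= c + A * (8%:R / M%:R).
Proof.
move=> M_gt0 A_ge0 FP; have M_n0 : M%:R != 0 :> R[i] by rewrite pnatr_eq0 -lt0n.
pose gx (j : 'I_M) := fejer M (x - grid M j).
pose gy (k : 'I_M) := fejer M (y - grid M k).
pose dx (j : 'I_M) : R[i] := `|cexp1 x - cexp1 (grid M j)| ^+ 2.
pose dy (k : 'I_M) : R[i] := `|cexp1 y - cexp1 (grid M k)| ^+ 2.
have gx1 : \sum_j gx j = 1 by apply: fejer_sum1.
have gy1 : \sum_k gy k = 1 by apply: fejer_sum1.
have conc z : \sum_(j < M) `|cexp1 z - cexp1 (grid M j)| ^+ 2 * fejer M (z - grid M j)
    <= 4%:R / M%:R.
  apply: le_trans (_ : \sum_(j < M) 4%:R / M%:R ^+ 2 <= _).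
    by apply: ler_sum => j _; apply: fejer_concentration.
  rewrite sumr_const card_ord -[X in X <= _]mulr_natr.
  by rewrite (_ : 4%:R / M%:R ^+ 2 * M%:R = 4%:R / M%:R) //; field.
have -> : F x y - fejer_interpolant F M x y =
    \sum_(j < M) \sum_(k < M) (F x y - F (grid M j) (grid M k)) * (gx j * gy k).
  have {1}-> : F x y = \sum_(j < M) \sum_(k < M) F x y * (gx j * gy k).
    under eq_bigr do rewrite -mulr_sumr -mulr_sumr gy1 mulr1.
    by rewrite -mulr_sumr gx1 mulr1.
  rewrite -sumrB; apply: eq_bigr => j _; rewrite -sumrB; apply: eq_bigr => k _.
  by rewrite mulrBl.
apply: le_trans (ler_norm_sum _ _ _) _.
apply: le_trans (_ : \sum_(j < M) \sum_(k < M) (c * (gx j * gy k) + A * (dx j * gx j * gy k + dy k * gy k * gx j)) <= _).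
  apply: ler_sum => j _; apply: le_trans (ler_norm_sum _ _ _) _; apply: ler_sum => k _.
  have g_ge0 : 0 <= gx j * gy k by rewrite mulr_ge0 ?fejer_ge0.
  rewrite normrM (ger0_norm g_ge0); apply: le_trans (ler_wpM2r g_ge0 (FP _ _ _ _)) _.
  by rewrite le_eqVlt; apply/orP; left; apply/eqP; rewrite /dx /dy; ring.
have -> : \sum_(j < M) \sum_(k < M) (c * (gx j * gy k) + A * (dx j * gx j * gy k + dy k * gy k * gx j)) =
    c + A * ((\sum_j dx j * gx j) + (\sum_k dy k * gy k)).
  set S := \sum_k dy k * _; transitivity (\sum_(j < M) (c * gx j + A * (dx j * gx j + S * gx j))).
    apply: eq_bigr => j _.
    transitivity (c * gx j * \sum_k gy k + A * (dx j * gx j * \sum_k gy k + S * gx j)).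
      rewrite /S !mulr_suml !mulr_sumr -big_split mulr_sumr -big_split /=.
      by apply: eq_bigr => k _; ring.
    by rewrite gy1 !mulr1.
  by rewrite big_split -!mulr_sumr big_split -!mulr_sumr /= gx1 !mulr1.
rewrite lerD2l ler_wpM2l // (_ : 8%:R / M%:R = 4%:R / M%:R + 4%:R / M%:R); last by field.
by apply: lerD; apply: conc.
Qed.

(** * Equidistribution with character weights *)

Lemma unit_coprime (q : nat) (x : 'Z_q) : (1 < q)%N -> (x \is a GRing.unit) = coprime x q.
Proof. by move=> q_gt1; rewrite -[x in LHS]natr_Zp unitZpE // coprime_sym. Qed.

Lemma ltn_Zp (q : nat) (x : 'Z_q) : (1 < q)%N -> (x < q)%N.
Proof. by move=> q_gt1; rewrite -[X in (_ < X)%N](Zp_cast q_gt1) ltn_ord. Qed.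

Lemma sum_units_mod (K : nmodType) (q : nat) (G : nat -> K) : (1 < q)%N ->
  \sum_(p <- units_mod q) G p = \sum_(x : 'Z_q | x \is a GRing.unit) G x.
Proof.
move=> q_gt1; rewrite -[RHS]big_filter -[RHS](big_map (fun x : 'Z_q => x : nat) predT G).
apply: perm_big; apply: uniq_perm.
- by rewrite filter_uniq // iota_uniq.
- by rewrite (map_inj_uniq val_inj) filter_uniq // index_enum_uniq.
move=> p; rewrite mem_filter mem_iota add1n ltnS; apply/idP/mapP.
  case/and3P=> cp p_gt0 pq; exists (inZp p) => /=.
    by rewrite mem_filter mem_index_enum andbT unit_coprime //= Zp_cast // coprime_modl.
  rewrite Zp_cast // modn_small // ltn_neqAle pq andbT.
  by apply: contraTneq cp => ->; rewrite /coprime gcdnn gtn_eqF.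
case=> x; rewrite mem_filter unit_coprime // => /andP[cx _] ->; rewrite cx (ltnW (ltn_Zp q x q_gt1)) andbT /=.
by rewrite lt0n; apply: contraTneq cx => ->; rewrite /coprime gcd0n gtn_eqF.
Qed.

Lemma natr_inv_mod (q : nat) (x : 'Z_q) : (1 < q)%N -> x \is a GRing.unit ->
  (inv_mod q x)%:R = x^-1 :> 'Z_q.
Proof.
move=> q_gt1 ux.
have invP (k : nat) : ((x * k) %% q == 1 %% q)%N -> k%:R = x^-1 :> 'Z_q.
  move=> e; apply: (mulrI ux); rewrite divrr // -[x in LHS]natr_Zp -natrM.
  by rewrite -Zp_nat_mod // (eqP e) Zp_nat_mod.
rewrite /inv_mod; case: pickP => [k /invP // | none].
have lt : ((x^-1)%R < q)%N by rewrite -[X in (_ < X)%N](Zp_cast q_gt1) ltn_ord.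
have := none (Ordinal lt) => /=; rewrite -!(val_Zp_nat q_gt1) natrM !natr_Zp divrr // eqxx.
Qed.

(** Real characters, constrained only at units. The reduction modulo [q] in the product rule mirrors
    multiplication of representatives in ['Z_q]. *)
Record unit_character (q : nat) (chi : nat -> int) : Prop := UnitCharacter {
  unit_character_sqr : forall p, coprime p q -> chi p ^+ 2 = 1;
  unit_characterM : forall m n, coprime m q -> coprime n q ->
    chi ((m * n) %% q)%N = chi m * chi n }.

Definition weighted_mean (chi : nat -> int) (q t : nat) (F : R -> R -> R[i]) : R[i] :=
  (totient q)%:R^-1 *
  \sum_(p <- units_mod q) (chi p)%:~R * F (grid q p) (grid q (t * inv_mod q p)).

(** Frequencies are differences of naturals because that is how they come out of the squared modulus
    in [fejer]. *)
Definition trig_monomial (a a' b b' : nat) (x y : R) : R[i] :=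
  cexp1 ((a%:R - a'%:R) * x) * cexp1 ((b%:R - b'%:R) * y).

Lemma cexp1_Zp_char (q a a' m : nat) : (1 < q)%N ->
  cexp1 ((a%:R - a'%:R) * grid q m) = Zp_char q ((a%:R - a'%:R) * m%:R).
Proof.
move=> q_gt1; rewrite [in RHS]mulrBl -!natrM -(additive_characterB _ _ _ _ _ (Zp_char_additive q q_gt1)).
rewrite !Zp_char_nat // -cexp1B; congr cexp1; rewrite /grid !natrM. field; rewrite pnatr_eq0; lia.
Qed.

Lemma unit_character_multiplicative (q : nat) (chi : nat -> int) : (1 < q)%N -> unit_character q chi ->
  unit_multiplicative R[i] 'Z_q (fun x => (chi x)%:~R).
Proof.
move=> q_gt1 [chi2 chiM]; split=> [x y | x]; rewrite !unit_coprime // => cx.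
  move=> cy; rewrite -intrM -chiM //=; congr ((chi _)%:~R).
  exact: (congr1 (modn (x * y)) (Zp_cast q_gt1)).
by apply/eqP; rewrite -(@eqrXn2 _ 2) // -intr_norm -rmorphXn /= real_normK ?num_real // chi2 // expr1n.
Qed.

Lemma weighted_mean_monomial (chi : nat -> int) (q t a a' b b' : nat) : (1 < q)%N ->
  weighted_mean chi q t (trig_monomial a a' b b') =
  (totient q)%:R^-1 * twisted_kloosterman R[i] 'Z_q (Zp_char q) (fun x => (chi x)%:~R)
     (a%:R - a'%:R) ((b%:R - b'%:R) * t%:R).
Proof.
move=> q_gt1; rewrite /weighted_mean sum_units_mod //; congr (_ * _).
apply: eq_bigr => x ux; congr (_ * _).
rewrite /trig_monomial !cexp1_Zp_char // -(additive_characterD _ _ _ (Zp_char_additive q q_gt1)).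
by rewrite natr_Zp natrM natr_inv_mod // mulrA.
Qed.

Lemma card_annihilatorB (q a b M : nat) : (1 < q)%N -> (a < M)%N -> (b < M)%N -> a != b ->
  (#|annihilator (a%:R - b%:R : 'Z_q)| <= M)%N.
Proof.
move=> q_gt1; wlog ab : a b / (b < a)%N => [hw|] aM bM a_b.
  case: (ltngtP b a) => ba; [exact: hw | | by rewrite ba eqxx in a_b].
  by rewrite -annihilatorN opprB; apply: hw => //; rewrite eq_sym.
rewrite -natrB ?(ltnW ab) //.
apply: leq_trans (card_annihilator_nat _ _ _ _) _ => //; first by rewrite subn_gt0.
by apply: leq_trans (leq_subr _ _) (ltnW aM).
Qed.

Lemma weighted_mean_monomial_bound : exists2 C : nat, (0 < C)%N &
  forall (chi : nat -> int) (q t M a a' b b' : nat),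
  (1 < q)%N -> unit_character q chi -> coprime t q ->
  (a < M)%N -> (a' < M)%N -> (b < M)%N -> (b' < M)%N -> (a != a') || (b != b') ->
  q%:R * `|weighted_mean chi q t (trig_monomial a a' b b')| ^+ 8 <= (C * M ^ 2)%N%:R.
Proof.
have [C C_gt0 CP] := kloosterman_Zp_bound; exists C => // chi q t M a a' b b' q_gt1 chiP ct.
move=> aM a'M bM b'M ne; rewrite weighted_mean_monomial //; apply: CP => //.
- exact: Zp_char_additive.
- exact: unit_character_multiplicative.
(* [t] enters only as a unit factor of the second coefficient, so the annihilator, and with it the
   bound, does not depend on [t]. *)
have ut : (t%:R : 'Z_q) \is a GRing.unit by rewrite unitZpE // coprime_sym.
rewrite card_annihilator_unit //; apply/orP.
by case/orP: ne => ne; [left | right]; apply: card_annihilatorB.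
Qed.

Lemma weighted_mean_diagonal (chi : nat -> int) (q t a b : nat) :
  weighted_mean chi q t (trig_monomial a a b b) = weighted_mean chi q t (fun _ _ => 1).
Proof.
congr (_ * _); apply: eq_bigr => p _.
by rewrite /trig_monomial !subrr !mul0r cexp1_0 mulr1.
Qed.

Lemma size_units_mod (q : nat) : (1 < q)%N -> size (units_mod q) = totient q.
Proof.
by move=> q_gt1; rewrite -sum1_size (sum_units_mod nat q (fun=> 1%N)) // sum1_card card_unit_Zp.
Qed.

Lemma weighted_mean_le (chi : nat -> int) (q t : nat) (F : R -> R -> R[i]) (c : R[i]) :
  (1 < q)%N -> unit_character q chi -> (forall x y, `|F x y| <= c) ->
  `|weighted_mean chi q t F| <= c.
Proof.
move=> q_gt1 chiP Fc; have phi_gt0 : 0 < (totient q)%:R :> R[i] by rewrite ltr0n totient_gt0 ltnW.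
rewrite normrM normfV normr_nat ler_pdivrMl //.
apply: le_trans (ler_norm_sum _ _ _) _.
apply: le_trans (_ : \sum_(p <- units_mod q) c <= _).
  rewrite big_seq [X in _ <= X]big_seq; apply: ler_sum => p; rewrite mem_filter => /andP[cp _].
  have chi1 : `|(chi p)%:~R| = 1 :> R[i].
    by apply/eqP; rewrite -(@eqrXn2 _ 2) // -intr_norm -rmorphXn /= real_normK ?num_real // (unit_character_sqr _ _ chiP) // expr1n.
  by rewrite normrM chi1 mul1r.
by rewrite big_const_seq count_predT size_units_mod // iter_addr_0 mulr_natl.
Qed.

Lemma weighted_meanB (chi : nat -> int) (q t : nat) (F G : R -> R -> R[i]) :
  weighted_mean chi q t F - weighted_mean chi q t G = weighted_mean chi q t (fun x y => F x y - G x y).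
Proof. by rewrite /weighted_mean -mulrBr -sumrB; under eq_bigr do rewrite -mulrBr. Qed.

Lemma weighted_mean_sum (I : finType) (chi : nat -> int) (q t : nat) (F : I -> R -> R -> R[i]) (c : I -> R[i]) :
  weighted_mean chi q t (fun x y => \sum_i c i * F i x y) = \sum_i c i * weighted_mean chi q t (F i).
Proof.
rewrite /weighted_mean; under eq_bigr do rewrite mulr_sumr; rewrite exchange_big mulr_sumr /=.
apply: eq_bigr => i _; rewrite mulrCA; congr (_ * _); rewrite mulr_sumr.
by apply: eq_bigr => p _; rewrite mulrCA.
Qed.

Definition fejer_coeff (F : R -> R -> R[i]) (M : nat) (z : ('I_M * 'I_M) * (('I_M * 'I_M) * ('I_M * 'I_M))) : R[i] :=
  let: ((j, k), ((a, a'), (b, b'))) := z in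
  (M%:R ^+ 4)^-1 * F (grid M j) (grid M k) *
    ((cexp1 ((a%:R - a'%:R) * grid M j))^* * (cexp1 ((b%:R - b'%:R) * grid M k))^*).

Lemma fejer_interpolantE (F : R -> R -> R[i]) (M : nat) (x y : R) :
  fejer_interpolant F M x y =
  \sum_z fejer_coeff F M z * trig_monomial z.2.1.1 z.2.1.2 z.2.2.1 z.2.2.2 x y.
Proof.
transitivity (\sum_(jk : 'I_M * 'I_M) \sum_(a : 'I_M * 'I_M) \sum_(b : 'I_M * 'I_M)
    fejer_coeff F M (jk, (a, b)) * trig_monomial a.1 a.2 b.1 b.2 x y); last first.
  under eq_bigr do rewrite pair_bigA; rewrite pair_bigA.
  by apply: eq_bigr => -[[j k] [[a a'] [b b']]].
rewrite /fejer_interpolant pair_bigA /=; apply: eq_bigr => -[j k] _ /=.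
rewrite !fejerE /= !pair_bigA /= mulrACA -invfM -exprD big_distrlr pair_bigA mulrA mulr_sumr /=.
apply: eq_bigr => -[[a a'] [b b']] _ /=.
by rewrite /trig_monomial; ring.
Qed.

(** At each grid point the [M ^ 2] diagonal terms carry no phase and together give the grid mean.
    The others are among [M ^ 6] terms with coefficients at most [B / M ^ 4], hence the factor
    [M ^ 2]. *)
Lemma weighted_mean_interpolant (F : R -> R -> R[i]) (chi : nat -> int) (q t M : nat) (B eta : R[i]) :
  (0 < M)%N -> 0 <= B -> 0 <= eta -> (forall x y, `|F x y| <= B) ->
  (forall a a' b b', (a < M)%N -> (a' < M)%N -> (b < M)%N -> (b' < M)%N -> (a != a') || (b != b') ->
     `|weighted_mean chi q t (trig_monomial a a' b b')| <= eta) ->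
  `|weighted_mean chi q t (fejer_interpolant F M) -
    weighted_mean chi q t (fun _ _ => 1) * grid_mean F M| <= M%:R ^+ 2 * B * eta.
Proof.
move=> M_gt0 B_ge0 eta_ge0 FB mono; have M_n0 : M%:R != 0 :> R[i] by rewrite pnatr_eq0 -lt0n.
set m := weighted_mean chi q t (fun _ _ => 1).
have -> : weighted_mean chi q t (fejer_interpolant F M) =
    \sum_z fejer_coeff F M z * weighted_mean chi q t (trig_monomial z.2.1.1 z.2.1.2 z.2.2.1 z.2.2.2).
  rewrite -weighted_mean_sum; congr (_ * _); apply: eq_bigr => p _; congr (_ * _).
  exact: fejer_interpolantE.
pose diag (z : ('I_M * 'I_M) * (('I_M * 'I_M) * ('I_M * 'I_M))) :=
  (z.2.1.1 == z.2.1.2) && (z.2.2.1 == z.2.2.2).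
have -> : m * grid_mean F M = \sum_(z | diag z) fejer_coeff F M z * m.
  rewrite -mulr_suml mulrC; congr (_ * _).
  rewrite /grid_mean.
  transitivity (\sum_(jk : 'I_M * 'I_M) \sum_(a : 'I_M * 'I_M | a.1 == a.2) \sum_(b : 'I_M * 'I_M | b.1 == b.2)
    fejer_coeff F M (jk, (a, b))); last first.
    under eq_bigr do rewrite pair_big; rewrite pair_big /=.
    by apply: eq_big => [[[j k] [[a a'] [b b']]] | [[j k] [[a a'] [b b']]] _].
  rewrite pair_bigA /= mulr_sumr; apply: eq_bigr => -[j k] _ /=.
  have diag_sum (G : 'I_M * 'I_M -> R[i]) : \sum_(a | a.1 == a.2) G a = \sum_a G (a, a).
    rewrite big_mkcond; transitivity (\sum_a (if a.1 == a.2 then G (a.1, a.2) else 0)).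
      by apply: eq_bigr => -[].
    rewrite -(pair_bigA _ (fun a b => if a == b then G (a, b) else 0)) /=.
    apply: eq_bigr => a _; rewrite -big_mkcond (big_pred1 a) // => b; exact: eq_sym.
  rewrite diag_sum; under eq_bigr do rewrite diag_sum.
  under eq_bigr do under eq_bigr do rewrite /fejer_coeff !subrr !mul0r cexp1_0 rmorph1 !mulr1.
  rewrite !sumr_const card_ord.
  by rewrite -[_ *+ M *+ M]mulrnA -[_ *+ (M * M)]mulr_natr natrM; field.
rewrite [X in X - _](bigID diag) /= -addrA [X in _ + X]addrC addrA -sumrB.
rewrite [X in X + _]big1 ?add0r; last first.
  move=> [[j k] [[a a'] [b b']]] /andP[/eqP /= -> /eqP ->].
  by rewrite weighted_mean_diagonal subrr.
apply: le_trans (ler_norm_sum _ _ _) _.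
apply: le_trans (_ : \sum_(z : ('I_M * 'I_M) * (('I_M * 'I_M) * ('I_M * 'I_M))) (M%:R ^+ 4)^-1 * B * eta <= _); last first.
  rewrite sumr_const !card_prod !card_ord -[_ *+ _]mulr_natr !natrM le_eqVlt.
  by apply/orP; left; apply/eqP; field.
rewrite big_mkcond /=; apply: ler_sum => -[[j k] [[a a'] [b b']]] _ /=.
have c_ge0 : 0 <= (M%:R ^+ 4)^-1 * B :> R[i] by rewrite mulr_ge0 ?invr_ge0 ?exprn_ge0 ?ler0n.
case: ifP => [nd | _]; last by rewrite mulr_ge0.
rewrite normrM ler_pM ?normr_ge0 //; last by rewrite mono // -negb_and.
rewrite !normrM !norm_conjC !norm_cexp1 !mulr1 normfV normrX normr_nat.
by rewrite ler_wpM2l ?invr_ge0 ?exprn_ge0 ?ler0n.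
Qed.

(** The error is [2 / n] from interpolation and [1 / n] from nonzero frequencies. [M] may be any
    large grid size, so that it can also be taken large enough for the Riemann sum; [Q] is fixed
    before [q], [t] and [chi]. *)
Lemma weighted_mean_equidistribution : forall (F : R -> R -> R[i]) (B : nat),
  (forall x y, `|F x y| <= B%:R) ->
  (forall n, (0 < n)%N -> exists A : nat, forall x y x' y', `|F x y - F x' y'| <=
     n%:R^-1 + A%:R * (`|cexp1 x - cexp1 x'| ^+ 2 + `|cexp1 y - cexp1 y'| ^+ 2)) ->
  forall n, (0 < n)%N -> exists M0, forall M, (M0 <= M)%N -> exists Q, forall q t chi,
    (Q <= q)%N -> coprime t q -> unit_character q chi ->
    `|weighted_mean chi q t F - weighted_mean chi q t (fun _ _ => 1) * grid_mean F M| <= 3%:R / n%:R.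
Proof.
move=> F B FB FA n n_gt0; have [A FAn] := FA n n_gt0.
have [C C_gt0 CP] := weighted_mean_monomial_bound.
(* Chosen so that [8 A / M <= 1 / n]. *)
exists (8 * A * n).+1 => M MM; have M_gt0 : (0 < M)%N by apply: leq_trans MM.
(* Monomial means of size at most [1 / h] give [M ^ 2 (B + 1) / h = 1 / n]; the successor keeps [h]
   positive. *)
pose h := (n * (B.+1 * M ^ 2))%N.
have h_gt0 : (0 < h)%N by rewrite !muln_gt0 n_gt0 M_gt0.
(* From [q |w| ^ 8 <= C M ^ 2], this size of [q] forces [|w| <= 1 / h]; the extra 2 ensures
   [q > 1]. *)
exists (C * M ^ 2 * h ^ 8).+2 => q t chi qQ ct chiP.
have q_gt1 : (1 < q)%N by apply: leq_trans qQ.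
have nR : 0 < n%:R :> R[i] by rewrite ltr0n.
have MR : 0 < M%:R :> R[i] by rewrite ltr0n.
have le1 : `|weighted_mean chi q t F - weighted_mean chi q t (fejer_interpolant F M)| <= 2%:R / n%:R.
  rewrite weighted_meanB; apply: weighted_mean_le => // x y.
  apply: le_trans (fejer_interpolant_approx F n%:R^-1 A%:R M x y M_gt0 (ler0n _ _) FAn) _.
  have -> : 2%:R / n%:R = n%:R^-1 + n%:R^-1 :> R[i] by ring.
  rewrite lerD2l mulrA ler_pdivrMr // ler_pdivlMl // -!natrM ler_nat.
  by apply: leq_trans MM; apply: leqW; apply: eq_leq; ring.
have le2 : `|weighted_mean chi q t (fejer_interpolant F M) -
    weighted_mean chi q t (fun _ _ => 1) * grid_mean F M| <= n%:R^-1.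
  apply: le_trans (_ : M%:R ^+ 2 * B.+1%:R * h%:R^-1 <= _); last first.
    rewrite /h !natrM !invfM le_eqVlt; apply/orP; left; apply/eqP.
    have bR : B.+1%:R != 0 :> R[i] by rewrite pnatr_eq0.
    move: bR (lt0r_neq0 nR) (lt0r_neq0 MR); move: (B.+1%:R : R[i]) => b b0 n0 m0.
    by field; rewrite n0 b0 m0.
  apply: weighted_mean_interpolant => //; rewrite ?invr_ge0 ?ler0n //.
    by move=> x y; apply: le_trans (FB x y) _; rewrite ler_nat.
  move=> a a' b b' aM a'M bM b'M ne.
  have := CP chi q t M a a' b b' q_gt1 chiP ct aM a'M bM b'M ne.
  set w := `|_| => le8; have hR : 0 < h%:R :> R[i] by rewrite ltr0n.
  rewrite -(@ler_pXn2r _ 8) ?nnegrE ?invr_ge0 ?ler0n ?normr_ge0 //.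
  rewrite exprVn -[X in _ <= X]mul1r ler_pdivlMr ?exprn_gt0 //.
  have qR : 0 < q%:R :> R[i] by rewrite ltr0n ltnW.
  rewrite -(ler_pM2l qR) mulr1 mulrA.
  apply: le_trans (ler_wpM2r _ le8) _; first by rewrite exprn_ge0 ?ler0n.
  by rewrite -natrX -natrM ler_nat; apply: leq_trans qQ; do 2 apply: leqW.
rewrite -(subrK (weighted_mean chi q t (fejer_interpolant F M)) (weighted_mean chi q t F)) -addrA.
apply: le_trans (ler_normD _ _) _.
have -> : 3%:R / n%:R = 2%:R / n%:R + n%:R^-1 :> R[i] by ring.
by apply: lerD.
Qed.

(** * Limits of character-weighted means *)

(** Bridge between two models of the complex numbers, whose ring operations agree by computation. *)
Definition toRi (z : Coquelicot.Complex.C) : R[i] := complex.Complex z.1 z.2.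

Lemma toRiD (x y : Coquelicot.Complex.C) : toRi (Cplus x y) = toRi x + toRi y.
Proof. by []. Qed.

Lemma toRiB (x y : Coquelicot.Complex.C) : toRi (Cminus x y) = toRi x - toRi y.
Proof. by []. Qed.

Lemma toRiM (x y : Coquelicot.Complex.C) : toRi (Cmult x y) = toRi x * toRi y.
Proof. by []. Qed.

Lemma toRi_R (x : R) : toRi (RtoC x) = x%:C%C.
Proof. by []. Qed.

Lemma norm_toRi (z : Coquelicot.Complex.C) : `|toRi z| = (Cmod z)%:C%C.
Proof.
by rewrite normc_def /Cmod RsqrtE RplusE !RpowE.
Qed.

Lemma INR_natr (n : nat) : INR n = n%:R.
Proof. by elim: n => // n IH; rewrite S_INR IH -natr1. Qed.

Lemma norm_toRi_le (z : Coquelicot.Complex.C) (c : R) : (`|toRi z| <= c%:C%C) = (Cmod z <= c).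
Proof. by rewrite norm_toRi lecR. Qed.

Lemma norm_cexp1B_sqr (x y : R) :
  `|cexp1 x - cexp1 y| ^+ 2 = (Rmult 4 (pow (sin (Rmult PI (Rminus x y))) 2))%:C%C.
Proof.
have -> : cexp1 x - cexp1 y = toRi (Rminus (cos (2%:R * PI * x)%R) (cos (2%:R * PI * y)%R),
   Rminus (sin (2%:R * PI * x)%R) (sin (2%:R * PI * y)%R)) by [].
rewrite norm_toRi -rmorphXn /= -circle_chord_sqr; congr (_%:C)%C.
rewrite -RpowE pow2_sqrt //; apply/RleP; rewrite RplusE !RpowE.
by rewrite addr_ge0 ?sqr_ge0.
Qed.

Definition toRi_fun (f : R * R -> Coquelicot.Complex.C) (x y : R) : R[i] := toRi (f (x, y)).

Lemma grid_mean_prefix_sum (f : R * R -> Coquelicot.Complex.C) (M : nat) :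
  grid_mean (toRi_fun f) M = toRi (Cmult (RtoC (Rinv (INR M))) (Cmult (RtoC (Rinv (INR M)))
    (prefix_sum M (fun j => prefix_sum M (fun k => f (Rdiv (INR j) (INR M), Rdiv (INR k) (INR M))))))).
Proof.
have sumE (g : nat -> Coquelicot.Complex.C) n : toRi (prefix_sum n g) = \sum_(j < n) toRi (g j).
  by elim: n => [|n IH]; rewrite ?big_ord0 // big_ord_recr /= toRiD IH.
rewrite !toRiM !toRi_R sumE mulrA RinvE INR_natr fmorphV rmorph_nat -invfM -expr2.
congr (_ * _); apply: eq_bigr => j _; rewrite sumE; apply: eq_bigr => k _.
by rewrite /toRi_fun /grid -!RdivE -!INR_natr.
Qed.

(** The mean of [chi] remains as a factor of the limit, so [chi] may be principal or not, and one
    [Q] serves all characters. *)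
Lemma weighted_mean_limit (f : R * R -> Coquelicot.Complex.C) :
  (forall z, continuous f z) ->
  (forall x y : R, f (Rplus x 1, y) = f (x, y)) -> (forall x y : R, f (x, Rplus y 1) = f (x, y)) ->
  forall e : R, 0 < e -> exists Q, forall q t chi, (Q <= q)%N -> (1 < q)%N /\
    (coprime t q -> unit_character q chi ->
     `|weighted_mean chi q t (toRi_fun f) -
       weighted_mean chi q t (fun _ _ => 1) * toRi (integral_T2 f)| <= e%:C%C).
Proof.
move=> fc f1 f2 e e_gt0.
have [B fB] := periodic_bounded f fc f1 f2.
have FB x y : `|toRi_fun f x y| <= B%:R.
  by rewrite -(rmorph_nat (real_complex R)) norm_toRi_le -INR_natr; apply/RleP.
have FA n : (0 < n)%N -> exists A : nat, forall x y x' y', `|toRi_fun f x y - toRi_fun f x' y'| <=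
     n%:R^-1 + A%:R * (`|cexp1 x - cexp1 x'| ^+ 2 + `|cexp1 y - cexp1 y'| ^+ 2).
  move=> n_gt0; have n_pos : 0 < n%:R^-1 :> R by rewrite invr_gt0 ltr0n.
  have [A HA] := periodic_korovkin f fc f1 f2 _ (elimT RltP n_pos).
  exists A => x y x' y'; rewrite !norm_cexp1B_sqr -!(rmorph_nat (real_complex R)) -fmorphV.
  rewrite -[X in _ <= _ + _ * X]rmorphD -rmorphM -rmorphD -toRiB norm_toRi_le -[A%:R]INR_natr.
  exact/RleP/HA.
have [n [n_lt n_gt0]] : exists n, (3%:R / n%:R < e / 2%:R :> R) /\ (0 < n)%N.
  have e6 : 0 < e / 6%:R by rewrite divr_gt0 ?ltr0n.
  have [n [/RltP n_lt /ssrnat.ltP n_gt0]] := archimed_cor1 _ (elimT RltP e6); exists n; split=> //.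
  rewrite INR_natr RinvE in n_lt.
  have -> : e / 2%:R = 3%:R * (e / 6%:R) by field.
  by rewrite ltr_pM2l ?ltr0n.
have e2 : 0 < e / 2%:R by rewrite divr_gt0 ?ltr0n.
have [M1 HM1] := riemann_sum_T2 f fc _ (elimT RltP e2).
have [M0 HM0] := weighted_mean_equidistribution _ B FB FA n n_gt0.
pose M := (M0 + M1).+1.
have [Q HQ] := HM0 M (leqW (leq_addr _ _)).
exists (maxn Q 2) => q t chi; rewrite geq_max => /andP[qQ q_gt1]; split=> // ct chiP.
have h1 := HQ q t chi qQ ct chiP.
have h2 : `|toRi (integral_T2 f) - grid_mean (toRi_fun f) M| <= (e / 2%:R)%:C%C.
  rewrite grid_mean_prefix_sum -toRiB norm_toRi_le; apply/RleP/HM1; last exact/ssrnat.ltP.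
  by apply/ssrnat.leP; rewrite leqW // leq_addl.
set c := weighted_mean chi q t (fun _ _ => 1) in h1 *.
have c_le1 : `|c| <= 1 by apply: weighted_mean_le => // x y; rewrite normr1.
set I := toRi _ in h2 *; set G := grid_mean _ _ in h1 h2.
have -> : weighted_mean chi q t (toRi_fun f) - c * I =
   (weighted_mean chi q t (toRi_fun f) - c * G) - c * (I - G) by ring.
apply: le_trans (ler_normB _ _) _.
have -> : e%:C%C = (e / 2%:R)%:C%C + (e / 2%:R)%:C%C by rewrite -rmorphD; congr (_%:C)%C; field.
apply: lerD; last first.
  by rewrite normrM; apply: le_trans h2; rewrite ler_piMl.
apply: le_trans h1 _.
have -> : 3%:R / n%:R = (3%:R / n%:R : R)%:C%C by rewrite rmorphM fmorphV !rmorph_nat.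
by rewrite lecR ltW.
Qed.

(** * Means of principal and nonprincipal characters *)

Lemma weighted_mean_one (q t : nat) : (1 < q)%N ->
  weighted_mean (fun=> 1) q t (fun _ _ => 1) = 1.
Proof.
move=> q_gt1; rewrite /weighted_mean; under eq_bigr do rewrite mulr1.
rewrite big_const_seq count_predT size_units_mod // iter_addr_0.
by rewrite mulVf // pnatr_eq0 -lt0n totient_gt0 ltnW.
Qed.

Lemma weighted_mean_nonprincipal (q t u : nat) (chi : nat -> int) :
  (1 < q)%N -> unit_character q chi -> coprime u q -> chi (u %% q)%N = -1 ->
  weighted_mean chi q t (fun _ _ => 1) = 0.
Proof.
move=> q_gt1 chiP cu chiu; rewrite /weighted_mean sum_units_mod //.
under eq_bigr do rewrite mulr1.
rewrite (sum_unit_character0 _ _ (fun x : 'Z_q => (chi x)%:~R) u%:R) ?mulr0 //.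
- exact: unit_character_multiplicative.
- by rewrite unitZpE // coprime_sym.
by rewrite val_Zp_nat // chiu rmorphN1 -subr_eq0 -opprD oppr_eq0 -mulr2n pnatr_eq0.
Qed.

Lemma unit_character_one (q : nat) : unit_character q (fun=> 1).
Proof. by split=> *; rewrite ?expr1n ?mulr1. Qed.

Lemma unit_character_mul (q : nat) (chi psi : nat -> int) :
  unit_character q chi -> unit_character q psi -> unit_character q (fun n => chi n * psi n).
Proof.
move=> [c2 cM] [p2 pM]; split=> [p cp | m n cm cn]; first by rewrite exprMn c2 ?p2 ?mulr1.
by rewrite cM ?pM // mulrACA.
Qed.

Lemma coprime_even_odd (p q : nat) : (4 %| q)%N -> coprime p q -> odd p.
Proof.
move=> q4 cp; have : coprime p 2 by apply: coprime_dvdr cp; apply: dvdn_trans q4.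
by rewrite coprime_sym prime_coprime // dvdn2 negbK.
Qed.

Lemma unit_character_chi4 (q : nat) : (4 %| q)%N -> unit_character q chi4.
Proof.
move=> q4; split=> [p _ | m n cm cn]; first exact: chi4_sqr.
by rewrite chi4_mod // chi4M ?(coprime_even_odd _ q).
Qed.

Lemma unit_character_jac_even (q : nat) : (0 < q)%N -> (4 %| q)%N -> unit_character q (jac q).
Proof.
move=> q_gt0 q4; split=> [p cp | m n cm cn]; first by rewrite jac_sqr // coprime_sym.
have cmn : coprime (m * n) q by rewrite coprimeMl cm cn.
rewrite -jacMr ?(coprime_even_odd _ q) //; apply: jac_congr; rewrite ?modn_mod //.
  by apply: (coprime_even_odd _ q) => //; rewrite coprime_modl.
exact: (coprime_even_odd _ q).
Qed.

Lemma unit_character_jac_odd (q : nat) : odd q -> unit_character q (jac^~ q).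
Proof.
move=> q_odd; split=> [p cp | m n _ _]; first exact: jac_sqr.
by rewrite jac_mod jacMl.
Qed.

(** * Restricted averages as combinations of character means *)

Lemma toRi_avg (f : R * R -> Coquelicot.Complex.C) (q t : nat) (P : nat -> bool) :
  toRi (avg f q t P) = (totient q)%:R^-1 *
    \sum_(p <- units_mod q) (P p)%:R * toRi_fun f (grid q p) (grid q (t * inv_mod q p)).
Proof.
rewrite /avg toRiM toRi_R RinvE INR_natr fmorphV rmorph_nat; congr (_ * _).
transitivity (\sum_(p <- units_mod q | P p) toRi_fun f (grid q p) (grid q (t * inv_mod q p))).
  rewrite -big_filter; elim: [seq p <- units_mod q | P p] => [|p s IH]; first by rewrite big_nil.
  by rewrite big_cons /= toRiD IH !INR_natr.
by rewrite big_mkcond; apply: eq_bigr => p _; case: (P p); rewrite ?mul1r ?mul0r.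
Qed.

Lemma avg_combination (I : finType) (f : R * R -> Coquelicot.Complex.C) (q t : nat)
    (P : nat -> bool) (w : I -> R[i]) (chi : I -> nat -> int) :
  (forall p, coprime p q -> (P p)%:R = \sum_i w i * (chi i p)%:~R :> R[i]) ->
  toRi (avg f q t P) = \sum_i w i * weighted_mean (chi i) q t (toRi_fun f).
Proof.
move=> PE; rewrite toRi_avg /weighted_mean.
under [RHS]eq_bigr do rewrite mulrCA mulr_sumr.
rewrite -mulr_sumr exchange_big /=; congr (_ * _).
rewrite big_seq [RHS]big_seq; apply: eq_bigr => p; rewrite mem_filter => /andP[cp _].
by rewrite PE // mulr_suml; apply: eq_bigr => i _; rewrite mulrA.
Qed.

(* [i0] is the index of the principal character; all others have mean zero. *)
Lemma avg_limit (I : finType) (i0 : I) (f : R * R -> Coquelicot.Complex.C) (w0 : R) :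
  (forall z, continuous f z) ->
  (forall x y : R, f (Rplus x 1, y) = f (x, y)) -> (forall x y : R, f (x, Rplus y 1) = f (x, y)) ->
  forall e : R, Rlt 0 e -> exists Q : nat, forall q t (P : nat -> bool) (w : I -> R[i]) (chi : I -> nat -> int),
    (Q <= q)%N -> t \in units_mod q ->
    (forall p, coprime p q -> (P p)%:R = \sum_i w i * (chi i p)%:~R :> R[i]) ->
    w i0 = w0%:C%C -> chi i0 = (fun=> 1) -> (forall i, `|w i| <= 1) ->
    (forall i, unit_character q (chi i)) ->
    (forall i, i != i0 -> exists2 u, coprime u q & chi i (u %% q)%N = -1) ->
    Rlt (Cmod (Cminus (avg f q t P) (Cmult (RtoC w0) (integral_T2 f)))) e.
Proof.
move=> fc f1 f2 e /RltP e_gt0.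
have I_gt0 : (0 < #|I|)%N by apply/card_gt0P; exists i0.
(* The [#|I|] errors of size [d] add up to [e / 2], which leaves room for the strict inequality. *)
pose d : R := (e / (2 * #|I|)%N%:R)%R.
have d_gt0 : 0 < d by rewrite divr_gt0 ?ltr0n ?muln_gt0.
have [Q HQ] := weighted_mean_limit f fc f1 f2 d d_gt0; exists Q => q t P w chi qQ tq PE w0E chi0 w1 chiP chiN.
have q_gt1 : (1 < q)%N by have [] := HQ q t (fun=> 1) qQ.
have ct : coprime t q by move: tq; rewrite mem_filter => /andP[].
apply/RltP; apply: (@le_lt_trans _ _ (e / 2%:R)); last by rewrite ltr_pdivrMr ?ltr0n // ltr_pMr ?ltr1n.
rewrite -norm_toRi_le toRiB toRiM toRi_R (avg_combination I f q t P w chi PE).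
have cE i : weighted_mean (chi i) q t (fun _ _ => 1) = (i == i0)%:R.
  have [-> | /chiN[u cu chiu]] := eqVneq i i0; first by rewrite chi0 weighted_mean_one.
  exact: (weighted_mean_nonprincipal q t u).
have -> : w0%:C%C * toRi (integral_T2 f) =
    \sum_i w i * (weighted_mean (chi i) q t (fun _ _ => 1) * toRi (integral_T2 f)).
  rewrite (bigD1 i0) //= big1 ?addr0 => [|i /negPf i_i0]; first by rewrite cE eqxx mul1r w0E.
  by rewrite cE i_i0 mul0r mulr0.
rewrite -sumrB; apply: le_trans (ler_norm_sum _ _ _) _.
apply: le_trans (_ : \sum_(i : I) d%:C%C <= _).
  apply: ler_sum => i _; rewrite -mulrBr normrM.
  have [_ /(_ ct (chiP i)) le_d] := HQ q t (chi i) qQ.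
  by apply: le_trans le_d; rewrite ler_piMl.
rewrite sumr_const -rmorphMn lecR -[d *+ _]mulr_natr /d natrM le_eqVlt; apply/orP; left; apply/eqP.
have : #|I|%:R != 0 :> R by rewrite pnatr_eq0 -lt0n.
by move: (#|I|%:R : R) => k k_n0; field.
Qed.

(** * The four limits *)

Lemma asboolE (P : Prop) (b : bool) : (P <-> b) -> asbool P = b.
Proof.
rewrite /asbool => PbE; case: excluded_middle_informative => [/PbE -> // | nP].
by apply/esym/negP => /PbE.
Qed.

Lemma sign_indicator (s x : int) : s ^+ 2 = 1 -> x ^+ 2 = 1 ->
  (x == s)%:R = 2^-1 * (1 + (s * x)%:~R) :> R[i].
Proof.
have two_n0 : 2%:R != 0 :> R[i] by rewrite pnatr_eq0.
move/eqP; rewrite sqrf_eq1 => /orP[] /eqP -> /eqP; rewrite sqrf_eq1 => /orP[] /eqP -> /=.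
all: by rewrite ?mulrNN ?mulr1 ?mul1r ?mulN1r ?rmorphN1 ?subrr ?mulr0 //= ?mulVf.
Qed.

Lemma norm_half_sign (s : int) : s ^+ 2 = 1 -> `|2^-1 * s%:~R| <= 1 :> R[i].
Proof.
move/eqP; rewrite sqrf_eq1 normrM normfV normr_nat.
have h : 2^-1 <= 1 :> R[i] by rewrite invf_le1 ?ler1n ?ltr0n.
by case/orP=> /eqP ->; rewrite ?rmorphN1 ?normrN normr1 mulr1.
Qed.

Lemma avg_limit_principal (f : R * R -> Coquelicot.Complex.C) :
  (forall z, continuous f z) ->
  (forall x y : R, f (Rplus x 1, y) = f (x, y)) -> (forall x y : R, f (x, Rplus y 1) = f (x, y)) ->
  forall e : R, Rlt 0 e -> exists Q : nat, forall q t : nat,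
    (Q <= q)%N -> t \in units_mod q ->
    Rlt (Cmod (Cminus (avg f q t predT) (integral_T2 f))) e.
Proof.
move=> fc f1 f2 e e_gt0.
have [Q HQ] := avg_limit unit tt f 1 fc f1 f2 e e_gt0; exists Q => q t qQ tq.
have := HQ q t predT (fun=> 1) (fun=> fun=> 1) qQ tq; rewrite Cmult_1_l; apply=> //.
- by move=> p _; rewrite (bigD1 tt) //= big1 ?addr0 ?mulr1 // => -[].
- by move=> _; rewrite normr1.
Qed.

(** The indicator of [chi = s] is [(1 + s chi) / 2]; the index [false] stands for the principal
    character. *)
Lemma avg_limit_sign (f : R * R -> Coquelicot.Complex.C) :
  (forall z, continuous f z) ->
  (forall x y : R, f (Rplus x 1, y) = f (x, y)) -> (forall x y : R, f (x, Rplus y 1) = f (x, y)) ->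
  forall e : R, Rlt 0 e -> exists Q : nat, forall q t (P : nat -> bool) (chi : nat -> int) (s : int),
    (Q <= q)%N -> t \in units_mod q -> s ^+ 2 = 1 -> unit_character q chi ->
    (exists2 u, coprime u q & chi (u %% q)%N = -1) ->
    (forall p, coprime p q -> P p = (chi p == s)) ->
    Rlt (Cmod (Cminus (avg f q t P) (Cmult (RtoC (Rinv 2)) (integral_T2 f)))) e.
Proof.
move=> fc f1 f2 e e_gt0.
have [Q HQ] := avg_limit bool false f (Rinv 2) fc f1 f2 e e_gt0.
exists Q => q t P chi s qQ tq s2 chiP chiN PE.
apply: (HQ q t P (fun b => 2^-1 * (if b then s else 1)%:~R) (fun b => if b then chi else fun=> 1)) => //.
- move=> p cp; rewrite PE // sign_indicator // ?(unit_character_sqr _ _ chiP) //.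
  by rewrite big_bool /= mulr1 intrM mulrDr mulr1 addrC mulrA.
- by rewrite RinvE (_ : IZR 2 = 2%:R) // mulr1 fmorphV rmorph_nat.
- by case; apply: norm_half_sign; rewrite ?expr1n.
- by case=> //; apply: unit_character_one.
- by case.
Qed.

(** The product of two such indicators expands in 1, [chi], [psi] and [chi psi]. A unit with
    [chi = 1] and [psi = -1] shows that both [psi] and [chi psi] are nonprincipal. *)
Lemma avg_limit_sign2 (f : R * R -> Coquelicot.Complex.C) :
  (forall z, continuous f z) ->
  (forall x y : R, f (Rplus x 1, y) = f (x, y)) -> (forall x y : R, f (x, Rplus y 1) = f (x, y)) ->
  forall e : R, Rlt 0 e -> exists Q : nat, forall q t (P : nat -> bool) (chi psi : nat -> int) (s s' : int),
    (Q <= q)%N -> t \in units_mod q -> s ^+ 2 = 1 -> s' ^+ 2 = 1 ->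
    unit_character q chi -> unit_character q psi ->
    (exists2 u, coprime u q & chi (u %% q)%N = -1) ->
    (exists2 u, coprime u q & chi (u %% q)%N = 1 /\ psi (u %% q)%N = -1) ->
    (forall p, coprime p q -> P p = (chi p == s) && (psi p == s')) ->
    Rlt (Cmod (Cminus (avg f q t P) (Cmult (RtoC (Rinv 4)) (integral_T2 f)))) e.
Proof.
move=> fc f1 f2 e e_gt0.
have [Q HQ] := avg_limit (bool * bool)%type (false, false) f (Rinv 4) fc f1 f2 e e_gt0.
exists Q => q t P chi psi s s' qQ tq s2 s2' chiP psiP chiN psiN PE.
apply: (HQ q t P
  (fun b => (2^-1 * (if b.1 then s else 1)%:~R) * (2^-1 * (if b.2 then s' else 1)%:~R))
  (fun b n => (if b.1 then chi n else 1) * (if b.2 then psi n else 1))) => //.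
- move=> p cp; rewrite PE // -mulnb natrM !sign_indicator ?(unit_character_sqr _ _ chiP) ?(unit_character_sqr _ _ psiP) //.
  rewrite -(pair_bigA _ (fun a b : bool => (2^-1 * (if a then s else 1)%:~R) * (2^-1 * (if b then s' else 1)%:~R) *
     ((if a then chi p else 1) * (if b then psi p else 1))%:~R)) /=.
  by rewrite !big_bool /= !intrM; ring.
- rewrite /= !mulr1 RinvE; have -> : IZR 4 = 4%:R by rewrite -INR_natr INR_IZR_INZ.
  by rewrite fmorphV rmorph_nat -invfM -natrM.
- case=> a b; rewrite normrM mulr_ile1 ?normr_ge0 // norm_half_sign //; [case: a | case: b] => //; exact: expr1n.
- by case=> -[] [] /=; apply: unit_character_mul => //; apply: unit_character_one.
have [u cu [cu1 pu]] := psiN; have [v cv cv1] := chiN.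
by case=> -[] [] //= _; [exists u | exists v | exists u] => //; rewrite ?cu1 ?pu ?cv1 ?mulr1 ?mul1r.
Qed.

Lemma jac_sign (a b : nat) : coprime a b -> jac a b = 1 \/ jac a b = -1.
Proof.
by move=> /jac_sqr/eqP; rewrite sqrf_eq1 => /orP[] /eqP; [left | right].
Qed.

Lemma eqb_jacobi (a b : nat) (s : int) (sigma : Z) :
  IZR sigma = s%:~R -> Z.eqb (jacobi a b) sigma = (jac a b == s).
Proof.
move=> sE; apply/idP/eqP => [/Z.eqb_eq e | e].
  by apply: (@intr_inj R); rewrite -IZR_jacobi e sE.
by apply/Z.eqb_eq/eq_IZR; rewrite IZR_jacobi e sE.
Qed.

Lemma eqb_mod4 (p : nat) (s : int) (sigma : Z) : odd p ->
  (sigma = Zpos xH /\ s = 1) \/ (sigma = Zneg xH /\ s = -1) ->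
  Z.eqb (Z.modulo (Z.of_nat p - sigma) 4) 0 = (chi4 p == s).
Proof.
move=> p_odd; have pE : Z.of_nat p = Z.add (Z.mul (Z.of_nat (p %/ 4)) 4) (Z.of_nat (p %% 4)).
  by rewrite {1}(divn_eq p 4); lia.
have : (p %% 4)%N \in [:: 1; 3]%N by rewrite !inE; lia.
rewrite /chi4 pE !inE => /orP[] /eqP -> [] [-> ->] /=; rewrite -Z.add_sub_assoc Z.add_comm Z_mod_plus_full //.
Qed.

(** [epsilon4 p] is 1 or i according to the sign [chi4 p], so the four values of [sigma] correspond
    to the four sign pairs [(s, s')]. *)
Lemma eq_epsilon_jacobi (q p : nat) (sigma : Coquelicot.Complex.C) (s s' : int) :
  coprime q p ->
  sigma = Cmult (if s == 1 then RtoC 1 else Ci) (RtoC s'%:~R) ->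
  s ^+ 2 = 1 -> s' ^+ 2 = 1 ->
  asbool (Cmult (epsilon4 p) (RtoC (IZR (jacobi q p))) = sigma) = (chi4 p == s) && (jac q p == s').
Proof.
move=> cqp -> /eqP; rewrite sqrf_eq1 => s2 /eqP; rewrite sqrf_eq1 => s2'.
apply: asboolE; rewrite IZR_jacobi /epsilon4 /chi4.
have r1 : (1 : int)%:~R = IZR (Zpos xH) :> R by [].
have rN1 : (-1 : int)%:~R = IZR (Zneg xH) :> R by rewrite rmorphN1.
case/orP: s2 => /eqP ->; case/orP: s2' => /eqP ->; case: (jac_sign q p cqp) => ->; case: ifP => _.
all: rewrite ?r1 ?rN1; split => // e.
all: move: (congr1 (fst : Coquelicot.Complex.C -> R) e) (congr1 (snd : Coquelicot.Complex.C -> R) e).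
all: by rewrite /= => h1 h2; exfalso; Lra.lra.
Qed.

Delimit Scope R_scope with R.
Delimit Scope Z_scope with Z.

Theorem theorem3p1 (f : R * R -> C)
  (f_per1 : forall x y : R, f ((x + 1)%R, y) = f (x, y))
  (f_per2 : forall x y : R, f (x, (y + 1)%R) = f (x, y))
  (f_cont : forall z : R * R, continuous f z) :
  (* (i) *)
  (forall e : R, (0 < e)%R -> exists Q : nat, forall q t : nat,
     (Q <= q)%N -> t \in units_mod q ->
     (Cmod (Cminus (avg f q t predT) (integral_T2 f)) < e)%R)
  /\
  (* (ii) *)
  (forall sigma : C, sigma = RtoC 1 \/ sigma = RtoC (-1) \/ sigma = Ci \/ sigma = Copp Ci ->
   forall e : R, (0 < e)%R -> exists Q : nat, forall q t : nat,
     (Q <= q)%N -> (q %% 4 = 0)%N -> ~ is_square q -> t \in units_mod q ->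
     (Cmod (Cminus
        (avg f q t (fun p => asbool (Cmult (epsilon4 p) (RtoC (IZR (jacobi q p))) = sigma)))
        (Cmult (RtoC (/ 4)) (integral_T2 f))) < e)%R)
  /\
  (* (iii) *)
  (forall sigma : Z, sigma = 1%Z \/ sigma = (-1)%Z ->
   forall e : R, (0 < e)%R -> exists Q : nat, forall q t : nat,
     (Q <= q)%N -> (q %% 4 = 0)%N -> t \in units_mod q ->
     (Cmod (Cminus
        (avg f q t (fun p => Z.eqb (Z.modulo (Z.of_nat p - sigma)%Z 4%Z) 0%Z))
        (Cmult (RtoC (/ 2)) (integral_T2 f))) < e)%R)
  /\
  (* (iv) *)
  (forall sigma : Z, sigma = 1%Z \/ sigma = (-1)%Z ->
   forall e : R, (0 < e)%R -> exists Q : nat, forall q t : nat,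
     (Q <= q)%N -> (q %% 2 = 1)%N -> ~ is_square q -> t \in units_mod q ->
     (Cmod (Cminus
        (avg f q t (fun p => Z.eqb (jacobi p q) sigma))
        (Cmult (RtoC (/ 2)) (integral_T2 f))) < e)%R).
Proof.
split; first exact: avg_limit_principal.
split.
  move=> sigma sigmaP e e_gt0; have [Q HQ] := avg_limit_sign2 f f_cont f_per1 f_per2 e e_gt0.
  have [s [s' [s2 s2' sE]]] : exists s s' : int, [/\ s ^+ 2 = 1, s' ^+ 2 = 1
      & sigma = Cmult (if s == 1 then RtoC 1 else Ci) (RtoC s'%:~R)].
    have r1 : RtoC (1 : int)%:~R = RtoC 1 by [].
    have rN1 : RtoC (-1 : int)%:~R = Copp (RtoC 1) by rewrite rmorphN1 -RtoC_opp.
    case: sigmaP => [->|[->|[->|->]]].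
    - by exists 1, 1; split; rewrite ?r1 //= Cmult_1_l.
    - by exists 1, (-1); split; rewrite ?rN1 //= Cmult_1_l -RtoC_opp.
    - by exists (-1), 1; split; rewrite ?r1 //= Cmult_1_r.
    - by exists (-1), (-1); split; rewrite ?rN1 //=; apply: injective_projections => /=; Lra.lra.
  (* The bound 2 excludes [q = 0], which is divisible by 4. *)
  exists (maxn Q 2) => q t; rewrite geq_max => /andP[qQ q_gt1] q_mod nsq tq.
  have q4 : (4 %| q)%N by apply/eqP.
  have q_gt0 : (0 < q)%N by apply: ltnW.
  have [u [cu u4 uN]] := jac_nonprincipal_even q q_gt0 q4 nsq.
  have u_odd := coprime_even_odd u q q4 cu.
  have um_odd : odd (u %% q) by apply: (coprime_even_odd _ q) => //; rewrite coprime_modl.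
  apply: (HQ q t _ chi4 (jac q) s s') => //.
  - exact: unit_character_chi4.
  - exact: unit_character_jac_even.
  (* [q - 1] is a unit congruent to 3 modulo 4, so [chi4] is nonprincipal. *)
  - exists q.-1; first by rewrite coprime_sym; apply: coprimenP.
    by rewrite modn_small ?prednK // /chi4; case: ifP => //; lia.
  - by exists u; rewrite ?chi4_mod // (jac_congr q _ u) // modn_mod.
  by move=> p cp; apply: eq_epsilon_jacobi => //; rewrite coprime_sym.
split.
  move=> sigma sigmaP e e_gt0; have [Q HQ] := avg_limit_sign f f_cont f_per1 f_per2 e e_gt0.
  exists (maxn Q 2) => q t; rewrite geq_max => /andP[qQ q_gt1] q_mod tq.
  have q4 : (4 %| q)%N by apply/eqP.
  have q_gt0 : (0 < q)%N by apply: ltnW.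
  have [s [s2 sE]] : exists s : int, s ^+ 2 = 1 /\
      ((sigma = Zpos xH /\ s = 1) \/ (sigma = Zneg xH /\ s = -1)).
    by case: sigmaP => ->; [exists 1 | exists (-1)]; split => //; [left | right].
  apply: (HQ q t _ chi4 s) => //.
  - exact: unit_character_chi4.
  - exists q.-1; first by rewrite coprime_sym; apply: coprimenP.
    by rewrite modn_small ?prednK // /chi4; case: ifP => //; lia.
  by move=> p cp; apply: eqb_mod4 => //; apply: (coprime_even_odd p q).
move=> sigma sigmaP e e_gt0; have [Q HQ] := avg_limit_sign f f_cont f_per1 f_per2 e e_gt0.
exists Q => q t qQ q_mod nsq tq.
have q_odd : odd q by rewrite -[odd q]eqb1 -modn2 q_mod.
have [s [s2 sE]] : exists s : int, s ^+ 2 = 1 /\ IZR sigma = s%:~R.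
  by case: sigmaP => ->; [exists 1 | exists (-1)]; split; rewrite // rmorphN1.
have [u cu uN] := jac_nonprincipal_odd q q_odd nsq.
apply: (HQ q t _ (jac^~ q) s) => //.
- exact: unit_character_jac_odd.
- by exists u; rewrite ?jac_mod.
by move=> p _; apply: eqb_jacobi.
Qed.
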